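(* Let $\tau$ be a type and let $e_1,e_2,e_3$ be closed expressions of type $\tau$ (i.e. $\emptyset\mid\emptyset\vdash e_i:\tau$). Then the following contextual equivalences hold at type $\tau$: (1) $e_1\simeq_{ctx}e_1\oplus e_1$; (2) $e_1\oplus e_2\simeq_{ctx}e_2\oplus e_1$; (3) $e_1\simeq_{ctx}e_1\oplus\mathsf{diverge}$; (4) $e_1\oplus(e_2\oplus e_3)\simeq_{ctx}(e_1\oplus e_2)\oplus e_3$; (5) $(e_1\oplus e_2);e_3\simeq_{ctx}(e_1;e_3)\oplus(e_2;e_3)$; (6) $e_1;(e_2\oplus e_3)\simeq_{ctx}(e_1;e_2)\oplus(e_1;e_3)$.
   Context: LANGUAGE. Types: $\tau::=\alpha\mid\mathsf{unit}\mid\mathsf{bool}\mid\mathsf{int}\mid\tau\times\tau\mid\tau+\tau\mid\tau\to\tau\mid\forall\alpha.\tau\mid\exists\alpha.\tau\mid\mu\alpha.\tau\mid\mathsf{ref}\,\tau$. Values: $()$, integers, booleans, locations $\ell$, $(v_1,v_2)$, $\mathsf{inl}(v)$, $\mathsf{inr}(v)$, $\mathsf{rec}\,f\,x=e$, $\Lambda.e$, $\mathsf{pack}\,v$, $\mathsf{fold}\,v$. Expressions: variables, values, $\mathsf{if}$, pairs, projections, $\mathsf{inl}/\mathsf{inr}$, $\mathsf{match}$, application, type application $e\langle\rangle$, $\mathsf{pack}\,e$, $\mathsf{unpack}\,e_1\,\mathsf{in}\,x.e_2$, $\mathsf{fold}\,e$, $\mathsf{unfold}\,e$, $\mathsf{ref}(e)$,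 $!e$, $e_1\leftarrow e_2$, $\mathsf{CAS}(e_1,e_2,e_3)$, $\mathsf{fork}\{e\}$, and the usual boolean/arithmetic operations. Sugar: $\lambda x.e$ is $\mathsf{rec}\,\_\,x=e$; $\mathsf{let}\,x=e_1\,\mathsf{in}\,e_2$ is $(\lambda x.e_2)\,e_1$; $e_1;e_2$ is $\mathsf{let}\,\_=e_1\,\mathsf{in}\,e_2$. Typing $\Xi\mid\Gamma\vdash e:\tau$ ($\Xi$ type variables, $\Gamma$ types of program variables) is standard for System F with recursive functions, iso-recursive types, references and existentials (no type annotations in terms; location literals are not typeable); $\mathsf{CAS}(e_1,e_2,e_3):\mathsf{bool}$ if $e_1:\mathsf{ref}\,\tau$, $e_2,e_3:\tau$ with $\tau$ a unit, boolean, integer or reference type; $\mathsf{fork}\{e\}:\mathsf{unit}$ if $e:\mathsf{unit}$. Semantics: call-by-value (arguments evaluated right to left) with evaluation contexts $K$; a state $\sigma$ is a finite partial map from locations to values; head steps are standard, with $\mathsf{CAS}(\ell,v_1,v_2)$ atomically comparing $\sigma(\ell)$ with $v_1$, returning $\mathsf{true}$ and storing $v_2$ if equal, otherwise returning $\mathsf{false}$. Thread-pool reduction $(\vec e,\sigma)\to_{tp}(\vec e',\sigma')$ takes one step in an arbitrary thread; $K[\mathsf{fork}\{e\}]$ steps to $K[()]$ and appends the new thread $e$ to the pool. CONTEXTUAL REFINEMENT AND EQUIVALENCE. A program context $\mathcal C$ is an expression with one hole (possibly under binders). $\mathcal C:(\Xi\mid\Gamma\vdash\tau)\Rightarrow(\Xi'\mid\Gamma'\vdash\tau')$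 is the standard context typing, derived from the typing rules by treating the hole as a term with $\Xi\mid\Gamma\vdash[\,]:\tau$. $\Xi\mid\Gamma\vdash e_1\precsim_{ctx}e_2:\tau$ means: for all $\tau'$, all $\mathcal C:(\Xi\mid\Gamma\vdash\tau)\Rightarrow(\emptyset\mid\emptyset\vdash\tau')$, all $v,\vec e_f,\sigma$: if $(\mathcal C[e_1],\emptyset)\to_{tp}^*(v::\vec e_f,\sigma)$ then there are $v',\vec e_f',\sigma'$ with $(\mathcal C[e_2],\emptyset)\to_{tp}^*(v'::\vec e_f',\sigma')$. $e_1\simeq_{ctx}e_2$ at type $\tau$ (for closed terms) means $\emptyset\mid\emptyset\vdash e_1\precsim_{ctx}e_2:\tau$ and $\emptyset\mid\emptyset\vdash e_2\precsim_{ctx}e_1:\tau$. PROGRAMS. $\mathsf{rand}:=\lambda().\ \mathsf{let}\,y=\mathsf{ref}(\mathsf{false})\,\mathsf{in}\ \mathsf{fork}\{y\leftarrow\mathsf{true}\};\ !y$. $\mathsf{or}:=\lambda t_1\,t_2.\ \mathsf{if}\,\mathsf{rand}\,()\,\mathsf{then}\,t_1\,()\,\mathsf{else}\,t_2\,()$. $e\oplus e':=\mathsf{or}\,(\lambda().\,e)\,(\lambda().\,e')$. $\mathsf{diverge}$ is an infinite loop, e.g. $(\mathsf{rec}\,f\,x=f\,x)\,()$. *)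

(* Defs.v *)
From Stdlib Require Import Bool ZArith String List Relations FMapPositive.
Import ListNotations.
Local Open Scope string_scope.
Local Open Scope list_scope.

(** * Types *)

(* Type variables are de Bruijn indices; a type context is the number of type
   variables in scope. *)
Inductive ty : Type :=
| TVar (i : nat)
| TUnit
| TBool
| TInt
| TProd (t1 t2 : ty)
| TSum (t1 t2 : ty)
| TArrow (t1 t2 : ty)
| TForall (t : ty)
| TExists (t : ty)
| TMu (t : ty)
| TRef (t : ty).

Fixpoint ty_wf (Xi : nat) (t : ty) : Prop :=
  match t with
  | TVar i => i < Xi
  | TUnit | TBool | TInt => True
  | TProd t1 t2 | TSum t1 t2 | TArrow t1 t2 => ty_wf Xi t1 /\ ty_wf Xi t2
  | TForall t | TExists t | TMu t => ty_wf (S Xi) t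
  | TRef t => ty_wf Xi t
  end.

Definition up_ren (r : nat -> nat) (i : nat) : nat :=
  match i with 0 => 0 | S i => S (r i) end.

Fixpoint ty_rename (r : nat -> nat) (t : ty) : ty :=
  match t with
  | TVar i => TVar (r i)
  | TUnit => TUnit
  | TBool => TBool
  | TInt => TInt
  | TProd t1 t2 => TProd (ty_rename r t1) (ty_rename r t2)
  | TSum t1 t2 => TSum (ty_rename r t1) (ty_rename r t2)
  | TArrow t1 t2 => TArrow (ty_rename r t1) (ty_rename r t2)
  | TForall t => TForall (ty_rename (up_ren r) t)
  | TExists t => TExists (ty_rename (up_ren r) t)
  | TMu t => TMu (ty_rename (up_ren r) t)
  | TRef t => TRef (ty_rename r t)
  end.

Definition ty_shift : ty -> ty := ty_rename S.

Definition up_subst (s : nat -> ty) (i : nat) : ty :=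
  match i with 0 => TVar 0 | S i => ty_shift (s i) end.

Fixpoint ty_subst (s : nat -> ty) (t : ty) : ty :=
  match t with
  | TVar i => s i
  | TUnit => TUnit
  | TBool => TBool
  | TInt => TInt
  | TProd t1 t2 => TProd (ty_subst s t1) (ty_subst s t2)
  | TSum t1 t2 => TSum (ty_subst s t1) (ty_subst s t2)
  | TArrow t1 t2 => TArrow (ty_subst s t1) (ty_subst s t2)
  | TForall t => TForall (ty_subst (up_subst s) t)
  | TExists t => TExists (ty_subst (up_subst s) t)
  | TMu t => TMu (ty_subst (up_subst s) t)
  | TRef t => TRef (ty_subst s t)
  end.

(* t[u/0] *)
Definition ty_inst (t u : ty) : ty :=
  ty_subst (fun i => match i with 0 => u | S i => TVar i end) t.

(** * Expressions and values *)

(* [BAnon] is the binder written [_]. *)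
Inductive binder : Type := BAnon | BNamed (x : string).
Coercion BNamed : string >-> binder.

Definition loc : Type := positive.

Inductive unop : Type := NegOp | NotOp.
Inductive binop : Type :=
| AddOp | SubOp | MulOp | LeOp | LtOp | EqOp | AndOp | OrOp | XorOp.

Inductive expr : Type :=
| Var (x : string)
| Unit
| Bool (b : bool)
| Int (n : Z)
| Loc (l : loc)
| UnOp (o : unop) (e : expr)
| BinOp (o : binop) (e1 e2 : expr)
| If (e e1 e2 : expr)
| Pair (e1 e2 : expr)
| Fst (e : expr)
| Snd (e : expr)
| Inl (e : expr)
| Inr (e : expr)
| Match (e : expr) (x1 : binder) (e1 : expr) (x2 : binder) (e2 : expr)
| Rec (f x : binder) (e : expr)
| App (e1 e2 : expr)
| TLam (e : expr)
| TApp (e : expr)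
| Pack (e : expr)
| Unpack (e1 : expr) (x : binder) (e2 : expr)
| Fold (e : expr)
| Unfold (e : expr)
| Ref (e : expr)
| Deref (e : expr)
| Store (e1 e2 : expr)
| CAS (e1 e2 e3 : expr)
| Fork (e : expr).

Inductive val : Type :=
| UnitV
| BoolV (b : bool)
| IntV (n : Z)
| LocV (l : loc)
| PairV (v1 v2 : val)
| InlV (v : val)
| InrV (v : val)
| RecV (f x : binder) (e : expr)
| TLamV (e : expr)
| PackV (v : val)
| FoldV (v : val).

Fixpoint of_val (v : val) : expr :=
  match v with
  | UnitV => Unit
  | BoolV b => Bool b
  | IntV n => Int n
  | LocV l => Loc l
  | PairV v1 v2 => Pair (of_val v1) (of_val v2)
  | InlV v => Inl (of_val v)
  | InrV v => Inr (of_val v)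
  | RecV f x e => Rec f x e
  | TLamV e => TLam e
  | PackV v => Pack (of_val v)
  | FoldV v => Fold (of_val v)
  end.

Definition binds (b : binder) (x : string) : bool :=
  match b with BAnon => false | BNamed y => String.eqb y x end.

(* [subst x s e] is e[s/x]. It is not capture-avoiding: reduction of closed
   programs only ever substitutes closed values. *)
Fixpoint subst (x : string) (s e : expr) : expr :=
  match e with
  | Var y => if String.eqb x y then s else Var y
  | Unit => Unit
  | Bool b => Bool b
  | Int n => Int n
  | Loc l => Loc l
  | UnOp o e => UnOp o (subst x s e)
  | BinOp o e1 e2 => BinOp o (subst x s e1) (subst x s e2)
  | If e e1 e2 => If (subst x s e) (subst x s e1) (subst x s e2)
  | Pair e1 e2 => Pair (subst x s e1) (subst x s e2)
  | Fst e => Fst (subst x s e)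
  | Snd e => Snd (subst x s e)
  | Inl e => Inl (subst x s e)
  | Inr e => Inr (subst x s e)
  | Match e x1 e1 x2 e2 =>
      Match (subst x s e)
        x1 (if binds x1 x then e1 else subst x s e1)
        x2 (if binds x2 x then e2 else subst x s e2)
  | Rec f y e => Rec f y (if binds f x || binds y x then e else subst x s e)
  | App e1 e2 => App (subst x s e1) (subst x s e2)
  | TLam e => TLam (subst x s e)
  | TApp e => TApp (subst x s e)
  | Pack e => Pack (subst x s e)
  | Unpack e1 y e2 =>
      Unpack (subst x s e1) y (if binds y x then e2 else subst x s e2)
  | Fold e => Fold (subst x s e)
  | Unfold e => Unfold (subst x s e)
  | Ref e => Ref (subst x s e)
  | Deref e => Deref (subst x s e)
  | Store e1 e2 => Store (subst x s e1) (subst x s e2)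
  | CAS e1 e2 e3 => CAS (subst x s e1) (subst x s e2) (subst x s e3)
  | Fork e => Fork (subst x s e)
  end.

Definition bsubst (b : binder) (s e : expr) : expr :=
  match b with BAnon => e | BNamed x => subst x s e end.

(** * Typing *)

Definition tctx : Type := list (string * ty).

(* The most recent binding comes first and shadows older ones. *)
Fixpoint lookup (Gamma : tctx) (x : string) : option ty :=
  match Gamma with
  | [] => None
  | (y, t) :: Gamma => if String.eqb x y then Some t else lookup Gamma x
  end.

Definition bcons (b : binder) (t : ty) (Gamma : tctx) : tctx :=
  match b with BAnon => Gamma | BNamed x => (x, t) :: Gamma end.

Definition tctx_shift (Gamma : tctx) : tctx :=
  map (fun p => (fst p, ty_shift (snd p))) Gamma.

Inductive cas_ty : ty -> Prop :=
| cas_unit : cas_ty TUnit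
| cas_bool : cas_ty TBool
| cas_int : cas_ty TInt
| cas_ref t : cas_ty (TRef t).

Inductive unop_typed : unop -> ty -> ty -> Prop :=
| ty_neg : unop_typed NegOp TInt TInt
| ty_not : unop_typed NotOp TBool TBool.

Inductive binop_typed : binop -> ty -> ty -> ty -> Prop :=
| ty_add : binop_typed AddOp TInt TInt TInt
| ty_sub : binop_typed SubOp TInt TInt TInt
| ty_mul : binop_typed MulOp TInt TInt TInt
| ty_le : binop_typed LeOp TInt TInt TBool
| ty_lt : binop_typed LtOp TInt TInt TBool
| ty_eq_int : binop_typed EqOp TInt TInt TBool
| ty_eq_bool : binop_typed EqOp TBool TBool TBool
| ty_and : binop_typed AndOp TBool TBool TBool
| ty_or : binop_typed OrOp TBool TBool TBool
| ty_xor : binop_typed XorOp TBool TBool TBool.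

(* [typed Xi Gamma e t] is Xi | Gamma |- e : t. There is no rule for [Loc]. *)
Inductive typed : nat -> tctx -> expr -> ty -> Prop :=
| T_Var Xi Gamma x t :
    lookup Gamma x = Some t ->
    typed Xi Gamma (Var x) t
| T_Unit Xi Gamma : typed Xi Gamma Unit TUnit
| T_Bool Xi Gamma b : typed Xi Gamma (Bool b) TBool
| T_Int Xi Gamma n : typed Xi Gamma (Int n) TInt
| T_UnOp Xi Gamma o e t t' :
    unop_typed o t t' ->
    typed Xi Gamma e t ->
    typed Xi Gamma (UnOp o e) t'
| T_BinOp Xi Gamma o e1 e2 t1 t2 t' :
    binop_typed o t1 t2 t' ->
    typed Xi Gamma e1 t1 ->
    typed Xi Gamma e2 t2 ->
    typed Xi Gamma (BinOp o e1 e2) t'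
| T_If Xi Gamma e e1 e2 t :
    typed Xi Gamma e TBool ->
    typed Xi Gamma e1 t ->
    typed Xi Gamma e2 t ->
    typed Xi Gamma (If e e1 e2) t
| T_Pair Xi Gamma e1 e2 t1 t2 :
    typed Xi Gamma e1 t1 ->
    typed Xi Gamma e2 t2 ->
    typed Xi Gamma (Pair e1 e2) (TProd t1 t2)
| T_Fst Xi Gamma e t1 t2 :
    typed Xi Gamma e (TProd t1 t2) ->
    typed Xi Gamma (Fst e) t1
| T_Snd Xi Gamma e t1 t2 :
    typed Xi Gamma e (TProd t1 t2) ->
    typed Xi Gamma (Snd e) t2
| T_Inl Xi Gamma e t1 t2 :
    ty_wf Xi t2 ->
    typed Xi Gamma e t1 ->
    typed Xi Gamma (Inl e) (TSum t1 t2)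
| T_Inr Xi Gamma e t1 t2 :
    ty_wf Xi t1 ->
    typed Xi Gamma e t2 ->
    typed Xi Gamma (Inr e) (TSum t1 t2)
| T_Match Xi Gamma e x1 e1 x2 e2 t1 t2 t :
    typed Xi Gamma e (TSum t1 t2) ->
    typed Xi (bcons x1 t1 Gamma) e1 t ->
    typed Xi (bcons x2 t2 Gamma) e2 t ->
    typed Xi Gamma (Match e x1 e1 x2 e2) t
| T_Rec Xi Gamma f x e t1 t2 :
    ty_wf Xi (TArrow t1 t2) ->
    typed Xi (bcons x t1 (bcons f (TArrow t1 t2) Gamma)) e t2 ->
    typed Xi Gamma (Rec f x e) (TArrow t1 t2)
| T_App Xi Gamma e1 e2 t1 t2 :
    typed Xi Gamma e1 (TArrow t1 t2) ->
    typed Xi Gamma e2 t1 ->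
    typed Xi Gamma (App e1 e2) t2
| T_TLam Xi Gamma e t :
    typed (S Xi) (tctx_shift Gamma) e t ->
    typed Xi Gamma (TLam e) (TForall t)
| T_TApp Xi Gamma e t u :
    ty_wf Xi u ->
    typed Xi Gamma e (TForall t) ->
    typed Xi Gamma (TApp e) (ty_inst t u)
| T_Pack Xi Gamma e t u :
    ty_wf (S Xi) t ->
    ty_wf Xi u ->
    typed Xi Gamma e (ty_inst t u) ->
    typed Xi Gamma (Pack e) (TExists t)
| T_Unpack Xi Gamma e1 x e2 t t' :
    typed Xi Gamma e1 (TExists t) ->
    typed (S Xi) (bcons x t (tctx_shift Gamma)) e2 (ty_shift t') ->
    typed Xi Gamma (Unpack e1 x e2) t'
| T_Fold Xi Gamma e t :
    ty_wf Xi (TMu t) ->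
    typed Xi Gamma e (ty_inst t (TMu t)) ->
    typed Xi Gamma (Fold e) (TMu t)
| T_Unfold Xi Gamma e t :
    typed Xi Gamma e (TMu t) ->
    typed Xi Gamma (Unfold e) (ty_inst t (TMu t))
| T_Ref Xi Gamma e t :
    typed Xi Gamma e t ->
    typed Xi Gamma (Ref e) (TRef t)
| T_Deref Xi Gamma e t :
    typed Xi Gamma e (TRef t) ->
    typed Xi Gamma (Deref e) t
| T_Store Xi Gamma e1 e2 t :
    typed Xi Gamma e1 (TRef t) ->
    typed Xi Gamma e2 t ->
    typed Xi Gamma (Store e1 e2) TUnit
| T_CAS Xi Gamma e1 e2 e3 t :
    cas_ty t ->
    typed Xi Gamma e1 (TRef t) ->
    typed Xi Gamma e2 t ->
    typed Xi Gamma e3 t ->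
    typed Xi Gamma (CAS e1 e2 e3) TBool
| T_Fork Xi Gamma e :
    typed Xi Gamma e TUnit ->
    typed Xi Gamma (Fork e) TUnit.

(** * Operational semantics *)

Definition state : Type := PositiveMap.t val.
Definition empty_state : state := PositiveMap.empty val.

Definition unop_eval (o : unop) (v : val) : option val :=
  match o, v with
  | NegOp, IntV n => Some (IntV (- n))
  | NotOp, BoolV b => Some (BoolV (negb b))
  | _, _ => None
  end.

Definition binop_eval (o : binop) (v1 v2 : val) : option val :=
  match v1, v2 with
  | IntV m, IntV n =>
      match o with
      | AddOp => Some (IntV (m + n))
      | SubOp => Some (IntV (m - n))
      | MulOp => Some (IntV (m * n))
      | LeOp => Some (BoolV (m <=? n)%Z)
      | LtOp => Some (BoolV (m <? n)%Z)
      | EqOp => Some (BoolV (m =? n)%Z)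
      | _ => None
      end
  | BoolV a, BoolV b =>
      match o with
      | EqOp => Some (BoolV (Bool.eqb a b))
      | AndOp => Some (BoolV (a && b))
      | OrOp => Some (BoolV (a || b))
      | XorOp => Some (BoolV (xorb a b))
      | _ => None
      end
  | _, _ => None
  end.

(* [head_step e s e' s' efs]: [efs] lists the newly forked threads. *)
Inductive head_step : expr -> state -> expr -> state -> list expr -> Prop :=
| HS_UnOp o v v' s :
    unop_eval o v = Some v' ->
    head_step (UnOp o (of_val v)) s (of_val v') s []
| HS_BinOp o v1 v2 v' s :
    binop_eval o v1 v2 = Some v' ->
    head_step (BinOp o (of_val v1) (of_val v2)) s (of_val v') s []
| HS_IfTrue e1 e2 s :
    head_step (If (Bool true) e1 e2) s e1 s []
| HS_IfFalse e1 e2 s :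
    head_step (If (Bool false) e1 e2) s e2 s []
| HS_Fst v1 v2 s :
    head_step (Fst (Pair (of_val v1) (of_val v2))) s (of_val v1) s []
| HS_Snd v1 v2 s :
    head_step (Snd (Pair (of_val v1) (of_val v2))) s (of_val v2) s []
| HS_MatchInl v x1 e1 x2 e2 s :
    head_step (Match (Inl (of_val v)) x1 e1 x2 e2) s
      (bsubst x1 (of_val v) e1) s []
| HS_MatchInr v x1 e1 x2 e2 s :
    head_step (Match (Inr (of_val v)) x1 e1 x2 e2) s
      (bsubst x2 (of_val v) e2) s []
(* the argument is substituted first: [x] shadows [f] when they coincide *)
| HS_App f x e v s :
    head_step (App (Rec f x e) (of_val v)) s
      (bsubst f (Rec f x e) (bsubst x (of_val v) e)) s []
| HS_TApp e s :
    head_step (TApp (TLam e)) s e s []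
| HS_Unpack v x e s :
    head_step (Unpack (Pack (of_val v)) x e) s (bsubst x (of_val v) e) s []
| HS_Unfold v s :
    head_step (Unfold (Fold (of_val v))) s (of_val v) s []
| HS_Ref v l s :
    PositiveMap.find l s = None ->
    head_step (Ref (of_val v)) s (Loc l) (PositiveMap.add l v s) []
| HS_Deref l v s :
    PositiveMap.find l s = Some v ->
    head_step (Deref (Loc l)) s (of_val v) s []
| HS_Store l v w s :
    PositiveMap.find l s = Some w ->
    head_step (Store (Loc l) (of_val v)) s Unit (PositiveMap.add l v s) []
| HS_CASSuc l v1 v2 s :
    PositiveMap.find l s = Some v1 ->
    head_step (CAS (Loc l) (of_val v1) (of_val v2)) s
      (Bool true) (PositiveMap.add l v2 s) []
| HS_CASFail l v v1 v2 s :
    PositiveMap.find l s = Some v ->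
    v <> v1 ->
    head_step (CAS (Loc l) (of_val v1) (of_val v2)) s (Bool false) s []
| HS_Fork e s :
    head_step (Fork e) s Unit s [e].

(* Evaluation contexts; arguments are evaluated from right to left. *)
Inductive ectx : Type :=
| KHole
| KUnOp (o : unop) (K : ectx)
| KBinOpL (o : binop) (K : ectx) (v2 : val)
| KBinOpR (o : binop) (e1 : expr) (K : ectx)
| KIf (K : ectx) (e1 e2 : expr)
| KPairL (K : ectx) (v2 : val)
| KPairR (e1 : expr) (K : ectx)
| KFst (K : ectx)
| KSnd (K : ectx)
| KInl (K : ectx)
| KInr (K : ectx)
| KMatch (K : ectx) (x1 : binder) (e1 : expr) (x2 : binder) (e2 : expr)
| KAppL (K : ectx) (v2 : val)
| KAppR (e1 : expr) (K : ectx)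
| KTApp (K : ectx)
| KPack (K : ectx)
| KUnpack (K : ectx) (x : binder) (e2 : expr)
| KFold (K : ectx)
| KUnfold (K : ectx)
| KRef (K : ectx)
| KDeref (K : ectx)
| KStoreL (K : ectx) (v2 : val)
| KStoreR (e1 : expr) (K : ectx)
| KCASL (K : ectx) (v2 v3 : val)
| KCASM (e1 : expr) (K : ectx) (v3 : val)
| KCASR (e1 e2 : expr) (K : ectx).

Fixpoint fill (K : ectx) (e : expr) : expr :=
  match K with
  | KHole => e
  | KUnOp o K => UnOp o (fill K e)
  | KBinOpL o K v2 => BinOp o (fill K e) (of_val v2)
  | KBinOpR o e1 K => BinOp o e1 (fill K e)
  | KIf K e1 e2 => If (fill K e) e1 e2
  | KPairL K v2 => Pair (fill K e) (of_val v2)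
  | KPairR e1 K => Pair e1 (fill K e)
  | KFst K => Fst (fill K e)
  | KSnd K => Snd (fill K e)
  | KInl K => Inl (fill K e)
  | KInr K => Inr (fill K e)
  | KMatch K x1 e1 x2 e2 => Match (fill K e) x1 e1 x2 e2
  | KAppL K v2 => App (fill K e) (of_val v2)
  | KAppR e1 K => App e1 (fill K e)
  | KTApp K => TApp (fill K e)
  | KPack K => Pack (fill K e)
  | KUnpack K x e2 => Unpack (fill K e) x e2
  | KFold K => Fold (fill K e)
  | KUnfold K => Unfold (fill K e)
  | KRef K => Ref (fill K e)
  | KDeref K => Deref (fill K e)
  | KStoreL K v2 => Store (fill K e) (of_val v2)
  | KStoreR e1 K => Store e1 (fill K e)
  | KCASL K v2 v3 => CAS (fill K e) (of_val v2) (of_val v3)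
  | KCASM e1 K v3 => CAS e1 (fill K e) (of_val v3)
  | KCASR e1 e2 K => CAS e1 e2 (fill K e)
  end.

Definition config : Type := list expr * state.

Inductive tp_step : config -> config -> Prop :=
| TP_step K e s e' s' efs ts1 ts2 :
    head_step e s e' s' efs ->
    tp_step (ts1 ++ fill K e :: ts2, s) (ts1 ++ fill K e' :: ts2 ++ efs, s').

Definition tp_steps : config -> config -> Prop := clos_refl_trans config tp_step.

(** * Contextual refinement *)

(* Program contexts: expressions with exactly one hole, possibly under
   binders. *)
Inductive pctx : Type :=
| CHole
| CUnOp (o : unop) (C : pctx)
| CBinOpL (o : binop) (C : pctx) (e2 : expr)
| CBinOpR (o : binop) (e1 : expr) (C : pctx)
| CIf (C : pctx) (e1 e2 : expr)
| CIfThen (e : expr) (C : pctx) (e2 : expr)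
| CIfElse (e e1 : expr) (C : pctx)
| CPairL (C : pctx) (e2 : expr)
| CPairR (e1 : expr) (C : pctx)
| CFst (C : pctx)
| CSnd (C : pctx)
| CInl (C : pctx)
| CInr (C : pctx)
| CMatch (C : pctx) (x1 : binder) (e1 : expr) (x2 : binder) (e2 : expr)
| CMatchL (e : expr) (x1 : binder) (C : pctx) (x2 : binder) (e2 : expr)
| CMatchR (e : expr) (x1 : binder) (e1 : expr) (x2 : binder) (C : pctx)
| CRec (f x : binder) (C : pctx)
| CAppL (C : pctx) (e2 : expr)
| CAppR (e1 : expr) (C : pctx)
| CTLam (C : pctx)
| CTApp (C : pctx)
| CPack (C : pctx)
| CUnpackL (C : pctx) (x : binder) (e2 : expr)
| CUnpackR (e1 : expr) (x : binder) (C : pctx)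
| CFold (C : pctx)
| CUnfold (C : pctx)
| CRef (C : pctx)
| CDeref (C : pctx)
| CStoreL (C : pctx) (e2 : expr)
| CStoreR (e1 : expr) (C : pctx)
| CCASL (C : pctx) (e2 e3 : expr)
| CCASM (e1 : expr) (C : pctx) (e3 : expr)
| CCASR (e1 e2 : expr) (C : pctx)
| CFork (C : pctx).

(* Plugging is not capture-avoiding. *)
Fixpoint plug (C : pctx) (e : expr) : expr :=
  match C with
  | CHole => e
  | CUnOp o C => UnOp o (plug C e)
  | CBinOpL o C e2 => BinOp o (plug C e) e2
  | CBinOpR o e1 C => BinOp o e1 (plug C e)
  | CIf C e1 e2 => If (plug C e) e1 e2
  | CIfThen e0 C e2 => If e0 (plug C e) e2
  | CIfElse e0 e1 C => If e0 e1 (plug C e)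
  | CPairL C e2 => Pair (plug C e) e2
  | CPairR e1 C => Pair e1 (plug C e)
  | CFst C => Fst (plug C e)
  | CSnd C => Snd (plug C e)
  | CInl C => Inl (plug C e)
  | CInr C => Inr (plug C e)
  | CMatch C x1 e1 x2 e2 => Match (plug C e) x1 e1 x2 e2
  | CMatchL e0 x1 C x2 e2 => Match e0 x1 (plug C e) x2 e2
  | CMatchR e0 x1 e1 x2 C => Match e0 x1 e1 x2 (plug C e)
  | CRec f x C => Rec f x (plug C e)
  | CAppL C e2 => App (plug C e) e2
  | CAppR e1 C => App e1 (plug C e)
  | CTLam C => TLam (plug C e)
  | CTApp C => TApp (plug C e)
  | CPack C => Pack (plug C e)
  | CUnpackL C x e2 => Unpack (plug C e) x e2
  | CUnpackR e1 x C => Unpack e1 x (plug C e)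
  | CFold C => Fold (plug C e)
  | CUnfold C => Unfold (plug C e)
  | CRef C => Ref (plug C e)
  | CDeref C => Deref (plug C e)
  | CStoreL C e2 => Store (plug C e) e2
  | CStoreR e1 C => Store e1 (plug C e)
  | CCASL C e2 e3 => CAS (plug C e) e2 e3
  | CCASM e1 C e3 => CAS e1 (plug C e) e3
  | CCASR e1 e2 C => CAS e1 e2 (plug C e)
  | CFork C => Fork (plug C e)
  end.

(* [typed_ctx Xi0 Gamma0 t0 C Xi Gamma t] is
   C : (Xi0 | Gamma0 |- t0) => (Xi | Gamma |- t). *)
Inductive typed_ctx (Xi0 : nat) (Gamma0 : tctx) (t0 : ty) :
    pctx -> nat -> tctx -> ty -> Prop :=
| TC_Hole : typed_ctx Xi0 Gamma0 t0 CHole Xi0 Gamma0 t0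
| TC_UnOp Xi Gamma o C t t' :
    unop_typed o t t' ->
    typed_ctx Xi0 Gamma0 t0 C Xi Gamma t ->
    typed_ctx Xi0 Gamma0 t0 (CUnOp o C) Xi Gamma t'
| TC_BinOpL Xi Gamma o C e2 t1 t2 t' :
    binop_typed o t1 t2 t' ->
    typed_ctx Xi0 Gamma0 t0 C Xi Gamma t1 ->
    typed Xi Gamma e2 t2 ->
    typed_ctx Xi0 Gamma0 t0 (CBinOpL o C e2) Xi Gamma t'
| TC_BinOpR Xi Gamma o e1 C t1 t2 t' :
    binop_typed o t1 t2 t' ->
    typed Xi Gamma e1 t1 ->
    typed_ctx Xi0 Gamma0 t0 C Xi Gamma t2 ->
    typed_ctx Xi0 Gamma0 t0 (CBinOpR o e1 C) Xi Gamma t'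
| TC_If Xi Gamma C e1 e2 t :
    typed_ctx Xi0 Gamma0 t0 C Xi Gamma TBool ->
    typed Xi Gamma e1 t ->
    typed Xi Gamma e2 t ->
    typed_ctx Xi0 Gamma0 t0 (CIf C e1 e2) Xi Gamma t
| TC_IfThen Xi Gamma e C e2 t :
    typed Xi Gamma e TBool ->
    typed_ctx Xi0 Gamma0 t0 C Xi Gamma t ->
    typed Xi Gamma e2 t ->
    typed_ctx Xi0 Gamma0 t0 (CIfThen e C e2) Xi Gamma t
| TC_IfElse Xi Gamma e e1 C t :
    typed Xi Gamma e TBool ->
    typed Xi Gamma e1 t ->
    typed_ctx Xi0 Gamma0 t0 C Xi Gamma t ->
    typed_ctx Xi0 Gamma0 t0 (CIfElse e e1 C) Xi Gamma t
| TC_PairL Xi Gamma C e2 t1 t2 :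
    typed_ctx Xi0 Gamma0 t0 C Xi Gamma t1 ->
    typed Xi Gamma e2 t2 ->
    typed_ctx Xi0 Gamma0 t0 (CPairL C e2) Xi Gamma (TProd t1 t2)
| TC_PairR Xi Gamma e1 C t1 t2 :
    typed Xi Gamma e1 t1 ->
    typed_ctx Xi0 Gamma0 t0 C Xi Gamma t2 ->
    typed_ctx Xi0 Gamma0 t0 (CPairR e1 C) Xi Gamma (TProd t1 t2)
| TC_Fst Xi Gamma C t1 t2 :
    typed_ctx Xi0 Gamma0 t0 C Xi Gamma (TProd t1 t2) ->
    typed_ctx Xi0 Gamma0 t0 (CFst C) Xi Gamma t1
| TC_Snd Xi Gamma C t1 t2 :
    typed_ctx Xi0 Gamma0 t0 C Xi Gamma (TProd t1 t2) ->
    typed_ctx Xi0 Gamma0 t0 (CSnd C) Xi Gamma t2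
| TC_Inl Xi Gamma C t1 t2 :
    ty_wf Xi t2 ->
    typed_ctx Xi0 Gamma0 t0 C Xi Gamma t1 ->
    typed_ctx Xi0 Gamma0 t0 (CInl C) Xi Gamma (TSum t1 t2)
| TC_Inr Xi Gamma C t1 t2 :
    ty_wf Xi t1 ->
    typed_ctx Xi0 Gamma0 t0 C Xi Gamma t2 ->
    typed_ctx Xi0 Gamma0 t0 (CInr C) Xi Gamma (TSum t1 t2)
| TC_Match Xi Gamma C x1 e1 x2 e2 t1 t2 t :
    typed_ctx Xi0 Gamma0 t0 C Xi Gamma (TSum t1 t2) ->
    typed Xi (bcons x1 t1 Gamma) e1 t ->
    typed Xi (bcons x2 t2 Gamma) e2 t ->
    typed_ctx Xi0 Gamma0 t0 (CMatch C x1 e1 x2 e2) Xi Gamma t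
| TC_MatchL Xi Gamma e x1 C x2 e2 t1 t2 t :
    typed Xi Gamma e (TSum t1 t2) ->
    typed_ctx Xi0 Gamma0 t0 C Xi (bcons x1 t1 Gamma) t ->
    typed Xi (bcons x2 t2 Gamma) e2 t ->
    typed_ctx Xi0 Gamma0 t0 (CMatchL e x1 C x2 e2) Xi Gamma t
| TC_MatchR Xi Gamma e x1 e1 x2 C t1 t2 t :
    typed Xi Gamma e (TSum t1 t2) ->
    typed Xi (bcons x1 t1 Gamma) e1 t ->
    typed_ctx Xi0 Gamma0 t0 C Xi (bcons x2 t2 Gamma) t ->
    typed_ctx Xi0 Gamma0 t0 (CMatchR e x1 e1 x2 C) Xi Gamma t
| TC_Rec Xi Gamma f x C t1 t2 :
    ty_wf Xi (TArrow t1 t2) ->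
    typed_ctx Xi0 Gamma0 t0 C Xi
      (bcons x t1 (bcons f (TArrow t1 t2) Gamma)) t2 ->
    typed_ctx Xi0 Gamma0 t0 (CRec f x C) Xi Gamma (TArrow t1 t2)
| TC_AppL Xi Gamma C e2 t1 t2 :
    typed_ctx Xi0 Gamma0 t0 C Xi Gamma (TArrow t1 t2) ->
    typed Xi Gamma e2 t1 ->
    typed_ctx Xi0 Gamma0 t0 (CAppL C e2) Xi Gamma t2
| TC_AppR Xi Gamma e1 C t1 t2 :
    typed Xi Gamma e1 (TArrow t1 t2) ->
    typed_ctx Xi0 Gamma0 t0 C Xi Gamma t1 ->
    typed_ctx Xi0 Gamma0 t0 (CAppR e1 C) Xi Gamma t2
| TC_TLam Xi Gamma C t :
    typed_ctx Xi0 Gamma0 t0 C (S Xi) (tctx_shift Gamma) t ->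
    typed_ctx Xi0 Gamma0 t0 (CTLam C) Xi Gamma (TForall t)
| TC_TApp Xi Gamma C t u :
    ty_wf Xi u ->
    typed_ctx Xi0 Gamma0 t0 C Xi Gamma (TForall t) ->
    typed_ctx Xi0 Gamma0 t0 (CTApp C) Xi Gamma (ty_inst t u)
| TC_Pack Xi Gamma C t u :
    ty_wf (S Xi) t ->
    ty_wf Xi u ->
    typed_ctx Xi0 Gamma0 t0 C Xi Gamma (ty_inst t u) ->
    typed_ctx Xi0 Gamma0 t0 (CPack C) Xi Gamma (TExists t)
| TC_UnpackL Xi Gamma C x e2 t t' :
    typed_ctx Xi0 Gamma0 t0 C Xi Gamma (TExists t) ->
    typed (S Xi) (bcons x t (tctx_shift Gamma)) e2 (ty_shift t') ->
    typed_ctx Xi0 Gamma0 t0 (CUnpackL C x e2) Xi Gamma t'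
| TC_UnpackR Xi Gamma e1 x C t t' :
    typed Xi Gamma e1 (TExists t) ->
    typed_ctx Xi0 Gamma0 t0 C (S Xi) (bcons x t (tctx_shift Gamma))
      (ty_shift t') ->
    typed_ctx Xi0 Gamma0 t0 (CUnpackR e1 x C) Xi Gamma t'
| TC_Fold Xi Gamma C t :
    ty_wf Xi (TMu t) ->
    typed_ctx Xi0 Gamma0 t0 C Xi Gamma (ty_inst t (TMu t)) ->
    typed_ctx Xi0 Gamma0 t0 (CFold C) Xi Gamma (TMu t)
| TC_Unfold Xi Gamma C t :
    typed_ctx Xi0 Gamma0 t0 C Xi Gamma (TMu t) ->
    typed_ctx Xi0 Gamma0 t0 (CUnfold C) Xi Gamma (ty_inst t (TMu t))
| TC_Ref Xi Gamma C t :
    typed_ctx Xi0 Gamma0 t0 C Xi Gamma t ->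
    typed_ctx Xi0 Gamma0 t0 (CRef C) Xi Gamma (TRef t)
| TC_Deref Xi Gamma C t :
    typed_ctx Xi0 Gamma0 t0 C Xi Gamma (TRef t) ->
    typed_ctx Xi0 Gamma0 t0 (CDeref C) Xi Gamma t
| TC_StoreL Xi Gamma C e2 t :
    typed_ctx Xi0 Gamma0 t0 C Xi Gamma (TRef t) ->
    typed Xi Gamma e2 t ->
    typed_ctx Xi0 Gamma0 t0 (CStoreL C e2) Xi Gamma TUnit
| TC_StoreR Xi Gamma e1 C t :
    typed Xi Gamma e1 (TRef t) ->
    typed_ctx Xi0 Gamma0 t0 C Xi Gamma t ->
    typed_ctx Xi0 Gamma0 t0 (CStoreR e1 C) Xi Gamma TUnit
| TC_CASL Xi Gamma C e2 e3 t :
    cas_ty t ->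
    typed_ctx Xi0 Gamma0 t0 C Xi Gamma (TRef t) ->
    typed Xi Gamma e2 t ->
    typed Xi Gamma e3 t ->
    typed_ctx Xi0 Gamma0 t0 (CCASL C e2 e3) Xi Gamma TBool
| TC_CASM Xi Gamma e1 C e3 t :
    cas_ty t ->
    typed Xi Gamma e1 (TRef t) ->
    typed_ctx Xi0 Gamma0 t0 C Xi Gamma t ->
    typed Xi Gamma e3 t ->
    typed_ctx Xi0 Gamma0 t0 (CCASM e1 C e3) Xi Gamma TBool
| TC_CASR Xi Gamma e1 e2 C t :
    cas_ty t ->
    typed Xi Gamma e1 (TRef t) ->
    typed Xi Gamma e2 t ->
    typed_ctx Xi0 Gamma0 t0 C Xi Gamma t ->
    typed_ctx Xi0 Gamma0 t0 (CCASR e1 e2 C) Xi Gamma TBool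
| TC_Fork Xi Gamma C :
    typed_ctx Xi0 Gamma0 t0 C Xi Gamma TUnit ->
    typed_ctx Xi0 Gamma0 t0 (CFork C) Xi Gamma TUnit.

Definition ctx_refines (Xi : nat) (Gamma : tctx) (e1 e2 : expr) (t : ty) : Prop :=
  forall (t' : ty) (C : pctx),
    typed_ctx Xi Gamma t C 0 [] t' ->
    forall (v : val) (efs : list expr) (s : state),
      tp_steps ([plug C e1], empty_state) (of_val v :: efs, s) ->
      exists (v' : val) (efs' : list expr) (s' : state),
        tp_steps ([plug C e2], empty_state) (of_val v' :: efs', s').

Definition ctx_equiv (e1 e2 : expr) (t : ty) : Prop :=
  ctx_refines 0 [] e1 e2 t /\ ctx_refines 0 [] e2 e1 t.

(** * Non-deterministic choice *)

Definition Lam (x : binder) (e : expr) : expr := Rec BAnon x e.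
Definition Let (x : binder) (e1 e2 : expr) : expr := App (Lam x e2) e1.
Definition Seq (e1 e2 : expr) : expr := Let BAnon e1 e2.

Definition rand : expr :=
  Lam BAnon
    (Let "y" (Ref (Bool false))
      (Seq (Fork (Store (Var "y") (Bool true))) (Deref (Var "y")))).

Definition nd_or : expr :=
  Lam "t1" (Lam "t2"
    (If (App rand Unit) (App (Var "t1") Unit) (App (Var "t2") Unit))).

Definition choice (e1 e2 : expr) : expr :=
  App (App nd_or (Lam BAnon e1)) (Lam BAnon e2).

Definition diverge : expr := App (Rec "f" "x" (App (Var "f") (Var "x"))) Unit.

Declare Scope lang_scope.
Infix "⊕" := choice (at level 50, left associativity) : lang_scope.
Notation "e1 ;; e2" := (Seq e1 e2) (at level 60, right associativity) : lang_scope.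

(* Main.v *)
Require Import Defs.
From Stdlib Require Import Bool ZArith String List Relations FMapPositive Lia.
Import ListNotations.
Local Open Scope string_scope.
Local Open Scope list_scope.

(** Call a configuration convergent if its main thread can reach a value.
    In any thread pool, heap and evaluation context, [e1 ⊕ e2] converges iff [e1]
    or [e2] does: the cell and the writer thread of [rand] are private, so they can
    be erased from a run, or inserted into it at a location larger than all those
    which the run allocates. As the choice in [e1 ;; (e2 ⊕ e3)] happens in a fixed
    frame, induction on the run moves it before the execution of [e1]; and a run
    with [diverge] in focus never makes progress there. Hence the two sides of each
    equation are equi-convergent in all evaluation contexts.

    Passing to arbitrary program contexts is a lock-step simulation between terms
    that agree up to occurrences of the two sides: whenever such an occurrence is
    about to be run, equi-convergence lets one replace the right side by the left.
    Types matter only for [CAS], which must compare values that contain no code. *)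

(** * Evaluation contexts and runs *)

(** Only the existence of a convergent run matters, so the scheduler may be steered: a choice
    amounts to a disjunction, and a branch that loops can be ignored. The delicate point is location
    names. Erasing the cell of a [rand] is sound only if nothing else mentions it, whence the
    requirement that configurations have no dangling locations. Inserting a cell must not block a
    later allocation of the given run, which is replayed with the very same locations. The
    simulation is needed because a context may put the hole in a function body, so that copies of
    the two programs travel through closures, the heap and other threads. Its induction is on the
    run of the left side. The right side is rewritten until the next redex appears there too, and
    equi-convergence is applied backwards to the convergence of the rewritten pool. After such a
    rewriting the term is compared with itself constructor by constructor, never as the same pair
    again; this makes the two sides proceed in lock-step. *)

Notation find := PositiveMap.find.

Fixpoint comp (K K' : ectx) : ectx :=
  match K with
  | KHole => K'
  | KUnOp o K => KUnOp o (comp K K')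
  | KBinOpL o K v2 => KBinOpL o (comp K K') v2
  | KBinOpR o e1 K => KBinOpR o e1 (comp K K')
  | KIf K e1 e2 => KIf (comp K K') e1 e2
  | KPairL K v2 => KPairL (comp K K') v2
  | KPairR e1 K => KPairR e1 (comp K K')
  | KFst K => KFst (comp K K')
  | KSnd K => KSnd (comp K K')
  | KInl K => KInl (comp K K')
  | KInr K => KInr (comp K K')
  | KMatch K x1 e1 x2 e2 => KMatch (comp K K') x1 e1 x2 e2
  | KAppL K v2 => KAppL (comp K K') v2
  | KAppR e1 K => KAppR e1 (comp K K')
  | KTApp K => KTApp (comp K K')
  | KPack K => KPack (comp K K')
  | KUnpack K x e2 => KUnpack (comp K K') x e2
  | KFold K => KFold (comp K K')
  | KUnfold K => KUnfold (comp K K')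
  | KRef K => KRef (comp K K')
  | KDeref K => KDeref (comp K K')
  | KStoreL K v2 => KStoreL (comp K K') v2
  | KStoreR e1 K => KStoreR e1 (comp K K')
  | KCASL K v2 v3 => KCASL (comp K K') v2 v3
  | KCASM e1 K v3 => KCASM e1 (comp K K') v3
  | KCASR e1 e2 K => KCASR e1 e2 (comp K K')
  end.

Lemma fill_comp K K' e : fill (comp K K') e = fill K (fill K' e).
Proof. induction K; simpl; congruence. Qed.

Definition is_val (e : expr) : Prop := exists v, e = of_val v.

Lemma of_val_is_val v : is_val (of_val v).
Proof. now exists v. Qed.

Lemma of_val_inj v w : of_val v = of_val w -> v = w.
Proof.
  revert w; induction v; destruct w; simpl; intros E; inversion E; subst;
    f_equal; auto.
Qed.

Lemma fill_is_val K e : is_val (fill K e) -> is_val e.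
Proof.
  induction K; simpl; intros [v E]; auto; try (now exists v);
    destruct v; simpl in E; inversion E; subst; apply IHK; eexists; eauto.
Qed.

Lemma head_step_not_val e s e' s' efs : head_step e s e' s' efs -> ~ is_val e.
Proof. intros H [v ->]; destruct v; inversion H. Qed.

(** Over-approximates the head redexes: every evaluated position holds a value, whatever its form.
    Unique decomposition needs no more than this. *)
Definition redex_args (e : expr) : Prop :=
  match e with
  | UnOp _ e | If e _ _ | Fst e | Snd e | Match e _ _ _ _ | TApp e
  | Unpack e _ _ | Unfold e | Ref e | Deref e => is_val e
  | BinOp _ e1 e2 | App e1 e2 | Store e1 e2 => is_val e1 /\ is_val e2
  | CAS e1 e2 e3 => is_val e1 /\ is_val e2 /\ is_val e3
  | Fork _ => True
  | _ => False
  end.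

Lemma head_step_redex_args e s e' s' efs : head_step e s e' s' efs -> redex_args e.
Proof.
  assert (V := of_val_is_val).
  destruct 1; simpl; repeat split; auto;
    first [ exact (V (BoolV _)) | exact (V (PairV _ _)) | exact (V (InlV _))
          | exact (V (InrV _)) | exact (V (RecV _ _ _)) | exact (V (TLamV _))
          | exact (V (PackV _)) | exact (V (FoldV _)) | exact (V (LocV _)) ].
Qed.

Lemma redex_args_fill_hole K e : redex_args (fill K e) -> ~ is_val e -> K = KHole.
Proof.
  intros H N; destruct K; auto; exfalso; apply N; simpl in H;
    intuition eauto using fill_is_val.
Qed.

(* Evaluation contexts of a thread extend any context around a non-value: this
   subsumes unique decomposition. *)
Lemma fill_decompose K e1 K0 e0 s e0' s' efs :
  fill K e1 = fill K0 e0 -> head_step e0 s e0' s' efs -> ~ is_val e1 ->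
  exists K1, K0 = comp K K1 /\ e1 = fill K1 e0.
Proof.
  intros E H N. assert (N0 := head_step_not_val _ _ _ _ _ H).
  assert (R := head_step_redex_args _ _ _ _ _ H). clear H.
  assert (M : forall K v, fill K e1 <> of_val v)
    by (intros K' v Ev; apply N, (fill_is_val K'); now exists v).
  assert (M0 : forall K v, fill K e0 <> of_val v)
    by (intros K' v Ev; apply N0, (fill_is_val K'); now exists v).
  revert K0 E; induction K; intros K0 E; [now exists K0|..];
    (destruct K0;
      [ simpl in E; subst e0; exfalso; simpl in R;
        intuition eauto using fill_is_val |..]);
    try discriminate E; simpl in E; injection E; clear E; intros; subst;
    try (exfalso; eapply M; eassumption);
    try (exfalso; eapply M; symmetry; eassumption);
    try (exfalso; eapply M0; eassumption);
    try (exfalso; eapply M0; symmetry; eassumption);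
    repeat match goal with
    | F : of_val _ = of_val _ |- _ => apply of_val_inj in F; subst
    end;
    match goal with
    | IH : forall K0, fill ?K e1 = fill K0 e0 -> _, F : fill ?K e1 = fill _ e0 |- _ =>
        destruct (IH _ F) as (K1 & -> & ->); now exists K1
    end.
Qed.

Lemma redex_args_not_val e : redex_args e -> ~ is_val e.
Proof. now intros H [v ->]; destruct v. Qed.

Lemma fill_redex_unique K e K0 e0 s e0' s' efs :
  fill K e = fill K0 e0 -> head_step e0 s e0' s' efs -> redex_args e ->
  K0 = K /\ e0 = e.
Proof.
  intros E H R.
  destruct (fill_decompose _ _ _ _ _ _ _ _ E H (redex_args_not_val _ R))
    as (K1 & -> & ->).
  apply redex_args_fill_hole in R; [|eapply head_step_not_val; eauto]. subst K1.
  split; auto. clear; induction K; simpl; congruence.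
Qed.

(** Inductive form of the existence of a convergent run: its induction principle walks along the run
    and exposes, at each step, the moving thread and its redex. *)
Inductive conv : list expr -> state -> Prop :=
| conv_done v efs s : conv (of_val v :: efs) s
| conv_step ts1 K e ts2 s e' s' efs :
    head_step e s e' s' efs ->
    conv (ts1 ++ fill K e' :: ts2 ++ efs) s' ->
    conv (ts1 ++ fill K e :: ts2) s.

Lemma tp_steps_conv ts s v efs s' :
  tp_steps (ts, s) (of_val v :: efs, s') -> conv ts s.
Proof.
  intros H; apply clos_rt_rt1n in H.
  remember (ts, s) as c eqn:Ec; remember (of_val v :: efs, s') as c' eqn:Ec'.
  revert ts s Ec; induction H as [c|c c1 c2 H1 _ IH]; intros; subst.
  - injection Ec as <- <-. constructor.
  - inversion H1; subst. econstructor; eauto.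
Qed.

Lemma conv_tp_steps ts s :
  conv ts s -> exists v efs s', tp_steps (ts, s) (of_val v :: efs, s').
Proof.
  induction 1 as [v efs s|ts1 K e ts2 s e' s' efs H _ (v & efs' & s2 & IH)].
  - exists v, efs, s. apply rt_refl.
  - exists v, efs', s2. eapply rt_trans; [apply rt_step|exact IH].
    now constructor.
Qed.

Lemma app_middle_inv {A} (l1 : list A) x l2 m1 y m2 :
  l1 ++ x :: l2 = m1 ++ y :: m2 ->
  (l1 = m1 /\ x = y /\ l2 = m2) \/
  (exists r, m1 = l1 ++ x :: r /\ l2 = r ++ y :: m2) \/
  (exists r, l1 = m1 ++ y :: r /\ m2 = r ++ x :: l2).
Proof.
  revert m1; induction l1 as [|z l1 IH]; intros [|w m1] E; simpl in E;
    injection E; clear E; intros E ->; subst.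
  - now left.
  - right; left. now exists m1.
  - right; right. now exists l1.
  - destruct (IH _ E) as [(-> & -> & ->)|[(r & -> & ->)|(r & -> & ->)]].
    + now left.
    + right; left. now exists r.
    + right; right. now exists r.
Qed.

(* Induction on a run that follows one thread [t], as long as it satisfies [I]. *)
Lemma conv_focus_ind (I : expr -> Prop) (P : list expr -> expr -> list expr -> state -> Prop) :
  (forall v ts1 t ts2 s, I t -> P (of_val v :: ts1) t ts2 s) ->
  (forall v ts2 s, I (of_val v) -> P [] (of_val v) ts2 s) ->
  (forall ts1 t ts2 s ts1' ts2' s', I t ->
     (forall f, tp_step (ts1 ++ f :: ts2, s) (ts1' ++ f :: ts2', s')) ->
     P ts1' t ts2' s' -> P ts1 t ts2 s) ->
  (forall ts1 K e ts2 s e' s' efs, I (fill K e) ->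
     head_step e s e' s' efs ->
     conv (ts1 ++ fill K e' :: ts2 ++ efs) s' ->
     (I (fill K e') -> P ts1 (fill K e') (ts2 ++ efs) s') ->
     P ts1 (fill K e) ts2 s) ->
  forall ts1 t ts2 s, I t -> conv (ts1 ++ t :: ts2) s -> P ts1 t ts2 s.
Proof.
  intros Hd Hm Ho Hs ts1 t ts2 s It H.
  remember (ts1 ++ t :: ts2) as ts eqn:E. revert ts1 t ts2 It E.
  induction H as [v efs s|l1 K e l2 s e' s' efs H C IH]; intros ts1 t ts2 It E.
  - destruct ts1; simpl in E; injection E; intros; subst; auto.
  - apply app_middle_inv in E as [(-> & <- & ->)|[(r & -> & ->)|(r & -> & ->)]].
    + eapply Hs; eauto.
    + apply (Ho _ _ _ _ (l1 ++ fill K e' :: r) (ts2 ++ efs) s'); auto.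
      * intros f. rewrite <- !app_assoc; simpl.
        replace (r ++ f :: ts2 ++ efs) with ((r ++ f :: ts2) ++ efs)
          by now rewrite <- app_assoc.
        now constructor.
      * apply IH; auto. now rewrite <- !app_assoc.
    + apply (Ho _ _ _ _ ts1 (r ++ fill K e' :: l2 ++ efs) s'); auto.
      * intros f.
        replace (ts1 ++ f :: r ++ fill K e :: l2)
          with ((ts1 ++ f :: r) ++ fill K e :: l2) by now rewrite <- app_assoc.
        replace (ts1 ++ f :: r ++ fill K e' :: l2 ++ efs)
          with ((ts1 ++ f :: r) ++ fill K e' :: l2 ++ efs) by now rewrite <- app_assoc.
        now constructor.
      * apply IH; auto. now rewrite <- app_assoc.
Qed.

Lemma conv_tp_step ts s ts' s' : tp_step (ts, s) (ts', s') -> conv ts' s' -> conv ts s.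
Proof. intros H; inversion H; subst. now apply conv_step. Qed.

(** Determinism, together with an untouched heap and no forks, makes such a step commute with
    everything that other threads do. *)
Definition pure_step (e e' : expr) : Prop :=
  (forall s, head_step e s e' s []) /\
  (forall s f s' efs, head_step e s f s' efs -> f = e' /\ s' = s /\ efs = []).

(** From left to right the step is anticipated: the moves of the other threads are replayed next to
    the advanced thread, until the given run takes the step itself or ends. *)
Lemma pure_step_conv ts1 K e e' ts2 s :
  pure_step e e' -> conv (ts1 ++ fill K e :: ts2) s <-> conv (ts1 ++ fill K e' :: ts2) s.
Proof.
  intros [Hs Hd]; split; intros C.
  - refine (conv_focus_ind (fun t => t = fill K e)
      (fun ts1 t ts2 s => conv (ts1 ++ fill K e' :: ts2) s) _ _ _ _ _ _ _ _ eq_refl C);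
      clear - Hs Hd.
    + intros; constructor.
    + intros v ts2 s E. exfalso.
      apply (head_step_not_val _ _ _ _ _ (Hs s)), (fill_is_val K). now exists v.
    + intros; eapply conv_tp_step; eauto.
    + intros ts1 K0 e0 ts2 s e0' s' efs E H C _.
      destruct (fill_redex_unique _ _ _ _ _ _ _ _ (eq_sym E) H) as [-> ->].
      { eapply head_step_redex_args, (Hs s). }
      destruct (Hd _ _ _ _ H) as (-> & -> & ->). now rewrite app_nil_r in C.
  - rewrite <- (app_nil_r ts2) in C. eapply conv_step; [apply Hs|exact C].
Qed.

Lemma pure_step_beta f x e v :
  pure_step (App (Rec f x e) (of_val v)) (bsubst f (Rec f x e) (bsubst x (of_val v) e)).
Proof.
  split; [constructor|]. intros s e' s' efs H. inversion H; subst.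
  match goal with E : of_val _ = of_val _ |- _ => apply of_val_inj in E as -> end. auto.
Qed.

Lemma pure_step_if (b : bool) e1 e2 : pure_step (If (Bool b) e1 e2) (if b then e1 else e2).
Proof.
  split; [destruct b; constructor|]. intros s e' s' efs H. now inversion H; subst.
Qed.

(** * Erasing and inserting private cells *)

(** A predicate is taken as parameter for the sake of two instances: being allocated, and differing
    from the private cell. *)
Fixpoint locs_in (P : loc -> Prop) (e : expr) : Prop :=
  match e with
  | Var _ | Unit | Bool _ | Int _ => True
  | Loc l => P l
  | UnOp _ e | Fst e | Snd e | Inl e | Inr e | Rec _ _ e | TLam e | TApp e
  | Pack e | Fold e | Unfold e | Ref e | Deref e | Fork e => locs_in P e
  | BinOp _ e1 e2 | Pair e1 e2 | App e1 e2 | Unpack e1 _ e2 | Store e1 e2 =>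
      locs_in P e1 /\ locs_in P e2
  | If e1 e2 e3 | Match e1 _ e2 _ e3 | CAS e1 e2 e3 =>
      locs_in P e1 /\ locs_in P e2 /\ locs_in P e3
  end.

Lemma locs_in_mono (P Q : loc -> Prop) e :
  (forall l, P l -> Q l) -> locs_in P e -> locs_in Q e.
Proof. intros PQ; induction e; simpl; intuition. Qed.

Lemma locs_in_subst P x v e : locs_in P v -> locs_in P e -> locs_in P (subst x v e).
Proof.
  intros Hv; induction e; simpl; intros He;
    repeat match goal with |- context [if ?c then _ else _] => destruct c end;
    simpl; intuition.
Qed.

Lemma locs_in_bsubst P x v e : locs_in P v -> locs_in P e -> locs_in P (bsubst x v e).
Proof. destruct x; simpl; auto using locs_in_subst. Qed.

(** Here and below, [fill K Unit] stands for the locations of [K] alone, which spares a second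
    recursion over contexts. *)
Lemma locs_in_fill P K e : locs_in P (fill K e) <-> locs_in P (fill K Unit) /\ locs_in P e.
Proof. induction K; simpl; tauto. Qed.

Definition heap_locs_in (P : loc -> Prop) (s : state) : Prop :=
  forall l v, find l s = Some v -> locs_in P (of_val v).

Lemma heap_locs_in_add P s l v :
  heap_locs_in P s -> locs_in P (of_val v) -> heap_locs_in P (PositiveMap.add l v s).
Proof.
  intros Hs Hv k w; destruct (Pos.eq_dec k l) as [->|N].
  - rewrite PositiveMap.gss. now intros [= <-].
  - rewrite PositiveMap.gso by auto. apply Hs.
Qed.

(** Locations are never forged: a step copies those of the redex and of the heap, and an allocation
    adds one, which the second premise covers. *)
Lemma head_step_locs P e s e' s' efs :
  head_step e s e' s' efs ->
  (forall l, find l s = None -> find l s' <> None -> P l) ->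
  locs_in P e -> heap_locs_in P s ->
  locs_in P e' /\ heap_locs_in P s' /\ Forall (locs_in P) efs.
Proof.
  destruct 1; simpl; intros New He Hs; (split; [|split]); auto; simpl;
    try (now intuition eauto using locs_in_bsubst, heap_locs_in_add).
  - destruct o, v; simpl in *; try discriminate;
      match goal with E : Some _ = Some _ |- _ => injection E as <- end; exact I.
  - destruct v1, v2; simpl in *; try discriminate; destruct o; try discriminate;
      match goal with E : Some _ = Some _ |- _ => injection E as <- end; exact I.
  - apply New; [assumption|]. now rewrite PositiveMap.gss.
Qed.

Definition in_dom (s : state) (l : loc) : Prop := find l s <> None.

(** Absence of dangling locations. Otherwise the allocation in [rand] could return a location that
    the surroundings already mention, and its cell would not be private. *)
Definition closed_config (ts : list expr) (s : state) : Prop :=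
  Forall (locs_in (in_dom s)) ts /\ heap_locs_in (in_dom s) s.

Lemma in_dom_add s l v k : in_dom s k -> in_dom (PositiveMap.add l v s) k.
Proof.
  unfold in_dom; destruct (Pos.eq_dec k l) as [->|N].
  - now rewrite PositiveMap.gss.
  - now rewrite PositiveMap.gso.
Qed.

Lemma head_step_dom e s e' s' efs :
  head_step e s e' s' efs -> forall l, in_dom s l -> in_dom s' l.
Proof. destruct 1; auto using in_dom_add. Qed.

Lemma closed_config_step ts s ts' s' :
  tp_step (ts, s) (ts', s') -> closed_config ts s -> closed_config ts' s'.
Proof.
  intros H [Ht Hs]; inversion H as [K e ? e' ? efs ts1 ts2 Hh]; subst.
  assert (D := head_step_dom _ _ _ _ _ Hh).
  assert (M : forall e, locs_in (in_dom s) e -> locs_in (in_dom s') e)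
    by (intros ? ?; eapply locs_in_mono; eauto).
  apply Forall_app in Ht as [Ht1 Ht2]; inversion Ht2 as [|? ? Ht Ht3]; subst.
  apply locs_in_fill in Ht as [HK He].
  destruct (head_step_locs (in_dom s') _ _ _ _ _ Hh) as (He' & Hs' & Hf);
    auto.
  { intros l v Hl. eauto. }
  split; auto. apply Forall_app; split; [eapply Forall_impl; eauto|].
  constructor; [apply locs_in_fill; auto|].
  apply Forall_app; split; auto. eapply Forall_impl; eauto.
Qed.

(** Nothing is said at [k], not even whether it is allocated: erasure removes the cell from the
    heap, insertion adds it. *)
Definition agree_off (k : loc) (s u : state) : Prop :=
  forall l, l <> k -> find l s = find l u.

Lemma agree_off_add k l v s u :
  agree_off k s u -> agree_off k (PositiveMap.add l v s) (PositiveMap.add l v u).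
Proof.
  intros A j Hj. destruct (Pos.eq_dec j l) as [->|N].
  - now rewrite !PositiveMap.gss.
  - now rewrite !PositiveMap.gso by auto; apply A.
Qed.

(** The disjunction covers erasing and inserting the cell [k]. Either way the step neither reads,
    writes nor allocates [k], so its lookups succeed alike in [u]. *)
Lemma head_step_agree_off k e s e' s' efs u :
  head_step e s e' s' efs -> agree_off k s u ->
  (in_dom s k /\ locs_in (fun l => l <> k) e) \/ ~ in_dom s' k ->
  exists u', head_step e u e' u' efs /\ agree_off k s' u'.
Proof.
  intros H A C. assert (D := head_step_dom _ _ _ _ _ H). unfold in_dom in *.
  destruct H.
  all: try (exists u; split; [constructor; solve [auto]|assumption]).
  all: match goal with
    | H : find ?l ?s = _ |- _ =>
      assert (l <> k) by
        (intros ->; rewrite ?PositiveMap.gss in C;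
         destruct C as [[C1 C2]|C]; [|apply C; congruence];
         simpl in *; intuition congruence);
      rewrite (A l) in H by assumption
    end.
  all: eexists; split; [econstructor; eauto|auto using agree_off_add].
Qed.

Lemma find_bound (s : state) : exists N, forall l, (N <= l)%positive -> find l s = None.
Proof.
  assert (B : forall xs : list (positive * val),
    exists N, forall l v, (N <= l)%positive -> ~ In (l, v) xs).
  { induction xs as [|[k w] xs [N IH]].
    - now exists 1%positive.
    - exists (Pos.max N (Pos.succ k)). intros l v Hl [[= <- <-]|Hi]; [lia|].
      apply (IH l v); auto; lia. }
  destruct (B (PositiveMap.elements s)) as [N HN]. exists N. intros l Hl.
  destruct (find l s) as [v|] eqn:E; auto.
  exfalso. apply (HN l v Hl), PositiveMap.elements_correct, E.
Qed.

(* The bound [N] exceeds every location allocated by the given run. *)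
Lemma conv_weaken ts u :
  conv ts u -> exists N, forall k, (N <= k)%positive -> ~ in_dom u k ->
  forall l1 g l2 s, l1 <> [] -> ts = l1 ++ l2 -> agree_off k u s ->
  conv (l1 ++ g :: l2) s.
Proof.
  induction 1 as [v efs u|ts1 K e ts2 u e' u' efs H C [N IH]].
  - exists 1%positive. intros k _ _ l1 g l2 s Hl E _.
    destruct l1; [easy|]. injection E as <- _. constructor.
  (* [M] bounds the heap after this step, so [k] is still free there; [N] does the same for the rest
     of the run. *)
  - destruct (find_bound u') as [M HM]. exists (Pos.max N M).
    intros k Hk Hku l1 g l2 s Hl E A.
    assert (Nk : ~ in_dom u' k) by (intros F; apply F, HM; lia).
    destruct (head_step_agree_off k _ _ _ _ _ s H A (or_intror Nk)) as (s' & H' & A').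
    apply app_eq_app in E as [r [[E1 E2]|[E1 E2]]].
    + subst ts1 l2.
      replace (l1 ++ g :: r ++ fill K e :: ts2) with ((l1 ++ g :: r) ++ fill K e :: ts2)
        by now rewrite <- app_assoc.
      eapply conv_step; [exact H'|]. rewrite <- app_assoc; simpl.
      apply (IH k); auto; [lia|now rewrite <- app_assoc].
    + destruct r as [|x r]; simpl in E2.
      * subst l2. rewrite app_nil_r in E1. subst l1.
        change (g :: fill K e :: ts2) with ([g] ++ fill K e :: ts2).
        rewrite app_assoc. eapply conv_step; [exact H'|].
        rewrite <- app_assoc; simpl. apply (IH k); auto. lia.
      * injection E2 as <- ->. subst l1. rewrite <- app_assoc; simpl.
        eapply conv_step; [exact H'|].
        replace (ts1 ++ fill K e' :: (r ++ g :: l2) ++ efs)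
          with ((ts1 ++ fill K e' :: r) ++ g :: l2 ++ efs)
          by (repeat (rewrite <- app_assoc; simpl); reflexivity).
        apply (IH k); auto; [lia|now destruct ts1|].
        repeat (rewrite <- app_assoc; simpl). reflexivity.
Qed.

Definition rand_body : expr :=
  Seq (Fork (Store (Var "y") (Bool true))) (Deref (Var "y")).
Definition after_alloc (l : loc) : expr :=
  Seq (Fork (Store (Loc l) (Bool true))) (Deref (Loc l)).

(** Roles of threads during one [rand]: [Keep] marks those present in both runs, [Drop] the writer,
    which is erased, and [Focus] the caller of [rand] in its context. *)
Inductive tag := Keep (e : expr) | Drop (g : expr) | Focus (K : ectx) (e : expr).

Definition big (t : tag) : expr :=
  match t with Keep e => e | Drop g => g | Focus K e => fill K e end.

(** The result [b] is known only when the cell is read; until then the focused thread stands still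
    in the small pool. *)
Definition small (b : bool) (t : tag) : list expr :=
  match t with Keep e => [e] | Drop _ => [] | Focus K _ => [fill K (Bool b)] end.

Definition not_focus (t : tag) : Prop :=
  match t with Focus _ _ => False | _ => True end.

(** The main thread decides convergence, so it must survive the erasure. *)
Definition head_kept (tl : list tag) : Prop :=
  match tl with Drop _ :: _ => False | _ => True end.

(** The listed terms are the successive stages of the writer and of [rand] after its allocation;
    nothing else may mention [k]. *)
Definition tag_ok (k : loc) (t : tag) : Prop :=
  match t with
  | Keep e => locs_in (fun l => l <> k) e
  | Drop g => g = Store (Loc k) (Bool true) \/ g = Unit
  | Focus K e => locs_in (fun l => l <> k) (fill K Unit) /\
      (e = after_alloc k \/ e = Seq Unit (Deref (Loc k)) \/ e = Deref (Loc k))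
  end.

Lemma big_map_Keep ts : map big (map Keep ts) = ts.
Proof. induction ts; simpl; congruence. Qed.

Lemma small_map_Keep b ts : flat_map (small b) (map Keep ts) = ts.
Proof. induction ts; simpl; congruence. Qed.

Lemma small_not_focus b c tl :
  Forall not_focus tl -> flat_map (small b) tl = flat_map (small c) tl.
Proof. induction 1 as [|[] tl]; simpl in *; try easy; congruence. Qed.

Lemma head_kept_replace tl1 t t' tl2 tl2' :
  (head_kept [t] -> head_kept [t']) ->
  head_kept (tl1 ++ t :: tl2) -> head_kept (tl1 ++ t' :: tl2').
Proof. destruct tl1; auto. Qed.

(** One boolean instantiates the whole small pool and is fixed by a single read; hence no second
    thread may depend on it. *)
Definition at_most_one_focus (tl : list tag) : Prop :=
  forall tl1 t tl2, tl = tl1 ++ t :: tl2 -> not_focus t \/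
    (Forall not_focus tl1 /\ Forall not_focus tl2).

Lemma at_most_one_focus_replace tl1 t t' tl2 tl3 :
  (not_focus t -> not_focus t') -> Forall not_focus tl3 ->
  at_most_one_focus (tl1 ++ t :: tl2) -> at_most_one_focus (tl1 ++ t' :: tl2 ++ tl3).
Proof.
  intros Ht H3 H m1 x m2 E.
  apply app_middle_inv in E as [(-> & <- & <-)|[(r & -> & E)|(r & -> & ->)]].
  - destruct (H _ _ _ eq_refl) as [?|[? ?]]; [left; auto|right; split; auto].
    apply Forall_app; auto.
  - apply app_eq_app in E as [q [[E1 E2]|[E1 E2]]].
    + destruct q as [|y q]; simpl in E2.
      * subst tl3. inversion H3; auto.
      * injection E2 as <- ->. subst tl2.
        rewrite app_comm_cons, app_assoc in H.
        destruct (H _ _ _ eq_refl) as [?|[F1 F2]]; [left; auto|right].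
        apply Forall_app in F1 as [F0 F1]. inversion F1; subst.
        split; apply Forall_app; auto.
    + subst tl3. apply Forall_app in H3 as [_ H3]. inversion H3; auto.
  - rewrite <- app_assoc in H. simpl in H.
    destruct (H _ _ _ eq_refl) as [?|[F1 F2]]; [left; auto|right].
    apply Forall_app in F2 as [F2 F3]. inversion F3; subst.
    split; auto. rewrite !Forall_app. repeat constructor; auto.
    apply Forall_app; auto.
Qed.

(* After the private cell [k] of a [rand] is allocated, the run of the full pool
   yields a run of the pool in which the cell and its writer thread are erased and
   the [rand] in focus has already returned some [b]. *)
Lemma conv_erase k ts s :
  conv ts s -> forall tl u, ts = map big tl -> Forall (tag_ok k) tl ->
  head_kept tl -> at_most_one_focus tl ->
  (exists c, find k s = Some (BoolV c)) -> agree_off k s u ->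
  heap_locs_in (fun l => l <> k) s ->
  exists b, conv (flat_map (small b) tl) u.
Proof.
  induction 1 as [v efs s|ts1 K e ts2 s e' s' efs H C IH];
    intros tl u E Ok Hd One [c Hc] A Hs.
  (* The run is over, so any boolean will do. The main thread is a [Keep], since a focused thread
     still contains a redex. *)
  - exists true. destruct tl as [|[e|g|K e] tl]; try easy; injection E as E _; simpl.
    + subst e. constructor.
    + exfalso. apply Forall_inv in Ok as [_ Hf].
      assert (V : is_val e) by (apply (fill_is_val K); now exists v).
      destruct V as [w ->]. destruct Hf as [F|[F|F]]; destruct w; discriminate.
  - symmetry in E. apply map_eq_app in E as (tl1 & tl2' & -> & <- & E).
    apply map_eq_cons in E as (t & tl2 & -> & E & <-).
    assert (Hk : in_dom s k) by (unfold in_dom; congruence).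
    apply Forall_app in Ok as [Ok1 Ok2]. inversion Ok2 as [|? ? Ot Ok3]; subst.
    destruct t as [f|g|K1 f]; simpl in E, Ot.
    + subst f. apply locs_in_fill in Ot as [LK Le].
      destruct (head_step_agree_off k _ _ _ _ _ u H A (or_introl (conj Hk Le)))
        as (u' & Hu & A').
      assert (L := head_step_locs (fun l => l <> k) _ _ _ _ _ H).
      destruct L as (Le' & Hs' & Lf); auto.
      { now intros l Hl _ ->. }
      destruct (IH (tl1 ++ Keep (fill K e') :: tl2 ++ map Keep efs) u') as [b Hb]; auto.
      * now rewrite map_app; simpl; rewrite map_app, big_map_Keep.
      * apply Forall_app; split; auto. constructor; [now apply locs_in_fill|].
        apply Forall_app; split; auto. now apply Forall_map.
      * eapply head_kept_replace; [|exact Hd]; auto.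
      * eapply at_most_one_focus_replace; [| |exact One]; auto.
        apply Forall_map. now apply Forall_forall.
      * assert (B : exists c, find k s' = Some (BoolV c)); [|exact B].
        assert (in_dom s' k) by (eapply head_step_dom; eauto).
        destruct H; simpl in *; eauto;
          exists c; rewrite PositiveMap.gso; auto; intros ->; try easy; congruence.
      * exists b. rewrite flat_map_app in Hb |- *; simpl in Hb |- *.
        rewrite flat_map_app, small_map_Keep in Hb.
        eapply conv_step; [exact Hu|exact Hb].
    (* The writer moves: only [k] changes, where the small heap is free to differ, so the small run
       takes no step. *)
    + destruct Ot as [->| ->].
      2:{ exfalso. apply (head_step_not_val _ _ _ _ _ H), (fill_is_val K).
          rewrite <- E. now exists UnitV. }
      destruct (fill_redex_unique KHole _ _ _ _ _ _ _ E H) as [-> ->].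
      { split; [now exists (LocV k)|now exists (BoolV true)]. }
      inversion H; subst.
      match goal with F : of_val ?v = Bool true |- _ =>
        destruct v; try discriminate; injection F as -> end.
      destruct (IH (tl1 ++ Drop Unit :: tl2 ++ []) u) as [b Hb].
      * now rewrite map_app; simpl; rewrite map_app.
      * rewrite app_nil_r. apply Forall_app; split; auto.
        constructor; auto. now right.
      * eapply head_kept_replace; [|exact Hd]; auto.
      * eapply at_most_one_focus_replace; [| |exact One]; auto.
      * exists true. now rewrite PositiveMap.gss.
      * intros l N. rewrite PositiveMap.gso by auto. now apply A.
      * now apply heap_locs_in_add.
      * exists b. rewrite app_nil_r, flat_map_app in Hb. now rewrite flat_map_app.
    + destruct Ot as [LK Hf].
      assert (Nf : Forall not_focus tl1 /\ Forall not_focus tl2)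
        by (destruct (One _ _ _ eq_refl) as [[]|?]; assumption).
      destruct Hf as [->|[->| ->]].
      (* The fork: the new writer is tagged [Drop], and the small pool does not move. *)
      * destruct (fill_redex_unique
          (comp K1 (KAppR (Lam BAnon (Deref (Loc k))) KHole))
          (Fork (Store (Loc k) (Bool true))) K e s e' s' efs) as [-> ->];
          [rewrite fill_comp; exact E|exact H|exact I|].
        inversion H; subst. rewrite !fill_comp in IH; simpl in IH.
        destruct (IH (tl1 ++ Focus K1 (Seq Unit (Deref (Loc k))) :: tl2
                   ++ [Drop (Store (Loc k) (Bool true))]) u) as [b Hb]; eauto.
        -- now rewrite map_app; simpl; rewrite map_app.
        -- apply Forall_app; split; auto. constructor; simpl; auto.
           apply Forall_app; split; auto. constructor; simpl; auto.
        -- eapply head_kept_replace; [|exact Hd]; auto.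
        -- eapply at_most_one_focus_replace; [| |exact One]; auto.
           repeat constructor.
        -- exists b. rewrite flat_map_app in Hb |- *; simpl in Hb |- *.
           now rewrite flat_map_app, app_nil_r in Hb.
      * destruct (fill_redex_unique _ _ _ _ _ _ _ _ E H) as [-> ->].
        { split; [now exists (RecV BAnon BAnon (Deref (Loc k)))|now exists UnitV]. }
        destruct (proj2 (pure_step_beta BAnon BAnon (Deref (Loc k)) UnitV) _ _ _ _ H)
          as (-> & -> & ->).
        destruct (IH (tl1 ++ Focus K1 (Deref (Loc k)) :: tl2 ++ []) u) as [b Hb]; eauto.
        -- now rewrite map_app; simpl; rewrite map_app.
        -- rewrite app_nil_r. apply Forall_app; split; auto. constructor; simpl; auto.
        -- eapply head_kept_replace; [|exact Hd]; auto.
        -- eapply at_most_one_focus_replace; [| |exact One]; auto.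
        -- exists b. rewrite flat_map_app in Hb |- *; simpl in Hb |- *.
           now rewrite app_nil_r in Hb.
      * destruct (fill_redex_unique _ _ _ _ _ _ _ _ E H) as [-> ->].
        { now exists (LocV k). }
        inversion H; subst.
        match goal with F : find k _ = Some ?v |- _ =>
          rewrite F in Hc; injection Hc as -> end.
        destruct (IH (tl1 ++ Keep (fill K1 (Bool c)) :: tl2 ++ []) u) as [b Hb]; eauto.
        -- now rewrite map_app; simpl; rewrite map_app.
        -- rewrite app_nil_r. apply Forall_app; split; auto.
           constructor; simpl; auto. now apply locs_in_fill.
        -- eapply head_kept_replace; [|exact Hd]; auto.
        -- eapply at_most_one_focus_replace; [| |exact One]; simpl; auto.
        (* No focus is left after the read, so the boolean of the induction hypothesis can be
           exchanged for the value [c] just read. *)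
        -- exists c. rewrite flat_map_app in Hb |- *; simpl in Hb |- *.
           rewrite app_nil_r in Hb.
           rewrite (small_not_focus c b tl1), (small_not_focus c b tl2) by apply Nf.
           exact Hb.
Qed.

(** * The choice operator in an evaluation context *)

Lemma closed_config_fill ts1 K e ts2 s :
  closed_config (ts1 ++ fill K e :: ts2) s <->
  closed_config (ts1 ++ fill K Unit :: ts2) s /\ locs_in (in_dom s) e.
Proof.
  unfold closed_config. rewrite !Forall_app, !Forall_cons_iff.
  rewrite (locs_in_fill _ K e). tauto.
Qed.

Lemma conv_after_alloc_inv k K ts1 ts2 s :
  conv (ts1 ++ fill K (after_alloc k) :: ts2) (PositiveMap.add k (BoolV false) s) ->
  ~ in_dom s k -> closed_config (ts1 ++ fill K Unit :: ts2) s ->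
  exists b, conv (ts1 ++ fill K (Bool b) :: ts2) s.
Proof.
  intros C Hk [W Ws].
  (* Here closedness of the configuration pays off: whatever is allocated in [s] differs from the
     fresh [k]. *)
  assert (M : forall e, locs_in (in_dom s) e -> locs_in (fun l => l <> k) e).
  { intros e. apply locs_in_mono. now intros l Hl ->. }
  apply Forall_app in W as [W1 W2]; inversion W2 as [|? ? W3 W4]; subst.
  destruct (conv_erase k _ _ C
    (map Keep ts1 ++ Focus K (after_alloc k) :: map Keep ts2) s) as [b Hb].
  - now rewrite map_app; simpl; rewrite !big_map_Keep.
  - apply Forall_app; split; [|constructor; simpl; auto];
      apply Forall_map; eapply Forall_impl; eauto; exact M.
  - now destruct ts1.
  - assert (N : forall ts, Forall not_focus (map Keep ts))
      by (intros ts; apply Forall_map, Forall_forall; simpl; auto).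
    intros tl1 t tl2 E.
    apply app_middle_inv in E as [(<- & <- & <-)|[(r & -> & E)|(r & E & ->)]].
    + right; auto.
    + left. specialize (N ts2). rewrite E in N. apply Forall_app in N as [_ N].
      now inversion N.
    + left. specialize (N ts1). rewrite E in N. apply Forall_app in N as [_ N].
      now inversion N.
  - exists false. now rewrite PositiveMap.gss.
  - intros l N. now rewrite PositiveMap.gso.
  - apply heap_locs_in_add; [|exact I]. intros l v F. apply M. eapply Ws; eauto.
  - exists b. now rewrite flat_map_app in Hb; simpl in Hb; rewrite !small_map_Keep in Hb.
Qed.

Lemma pure_step_rand :
  pure_step (App rand Unit) (App (Lam "y" rand_body) (Ref (Bool false))).
Proof. exact (pure_step_beta BAnon BAnon (Let "y" (Ref (Bool false)) rand_body) UnitV). Qed.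

Lemma pure_step_rand_body k : pure_step (App (Lam "y" rand_body) (Loc k)) (after_alloc k).
Proof. exact (pure_step_beta BAnon "y" rand_body (LocV k)). Qed.

Lemma pure_step_seq v e : pure_step (Seq (of_val v) e) e.
Proof. exact (pure_step_beta BAnon BAnon e v). Qed.

(** Other threads may move before the cell is allocated. The run is therefore followed up to the
    allocation, since only then is the heap known in which the cell is fresh. *)
Lemma conv_rand_inv ts1 K ts2 s :
  conv (ts1 ++ fill K (App rand Unit) :: ts2) s ->
  closed_config (ts1 ++ fill K Unit :: ts2) s ->
  exists b, conv (ts1 ++ fill K (Bool b) :: ts2) s.
Proof.
  intros C. apply (pure_step_conv _ _ _ _ _ _ pure_step_rand) in C.
  set (K1 := comp K (KAppR (Lam "y" rand_body) KHole)).
  assert (EK : forall e, fill K1 e = fill K (App (Lam "y" rand_body) e))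
    by (intros e; apply fill_comp).
  rewrite <- EK in C.
  refine (conv_focus_ind (fun t => t = fill K1 (Ref (Bool false)))
    (fun ts1 t ts2 s => closed_config (ts1 ++ fill K Unit :: ts2) s ->
       exists b, conv (ts1 ++ fill K (Bool b) :: ts2) s) _ _ _ _ _ _ _ _ eq_refl C);
    clear - EK.
  - intros v ts1 t ts2 s _ _. exists true. constructor.
  - intros v ts2 s E _. exfalso.
    destruct (fill_is_val K1 (Ref (Bool false))) as [w Hw]; [now exists v|].
    now destruct w.
  - intros ts1 t ts2 s ts1' ts2' s' _ H IH W.
    destruct (IH (closed_config_step _ _ _ _ (H _) W)) as [b Hb].
    exists b. eapply conv_tp_step; [apply H|exact Hb].
  - intros ts1 K0 e0 ts2 s e' s' efs E H C _ W.
    destruct (fill_redex_unique _ _ _ _ _ _ _ _ (eq_sym E) H) as [-> ->].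
    { now exists (BoolV false). }
    inversion H; subst.
    match goal with F : of_val ?v = Bool false |- _ =>
      destruct v; try discriminate; injection F as -> end.
    rewrite EK, app_nil_r in C.
    apply (pure_step_conv _ _ _ _ _ _ (pure_step_rand_body _)) in C.
    eapply conv_after_alloc_inv; [exact C|unfold in_dom; congruence|exact W].
Qed.

(** All of [rand] is scheduled at once. To obtain [true] the writer runs before the read; to obtain
    [false] its store is left pending forever. *)
Lemma conv_rand ts1 K ts2 s b :
  conv (ts1 ++ fill K (Bool b) :: ts2) s ->
  conv (ts1 ++ fill K (App rand Unit) :: ts2) s.
Proof.
  intros C. apply (pure_step_conv _ _ _ _ _ _ pure_step_rand).
  destruct (conv_weaken _ _ C) as [N HN]. destruct (find_bound s) as [M HM].
  (* [M] makes [k] free now, and [N] keeps it clear of all later allocations. *)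
  set (k := Pos.max N M).
  assert (Hk : find k s = None) by (apply HM; lia).
  set (s1 := PositiveMap.add k (BoolV false) s).
  assert (A1 : agree_off k s s1)
    by (intros l Hl; unfold s1; now rewrite PositiveMap.gso).
  assert (F1 : find k s1 = Some (BoolV false)) by apply PositiveMap.gss.
  pose (K1 := comp K (KAppR (Lam "y" rand_body) KHole)).
  assert (EK : forall e, fill K1 e = fill K (App (Lam "y" rand_body) e))
    by (intros e; apply fill_comp).
  rewrite <- EK.
  eapply conv_step; [apply (HS_Ref (BoolV false) k s Hk)|]. fold s1.
  rewrite EK, app_nil_r. apply (pure_step_conv _ _ _ _ _ _ (pure_step_rand_body _)).
  pose (K2 := comp K (KAppR (Lam BAnon (Deref (Loc k))) KHole)).
  assert (EK2 : forall e, fill K2 e = fill K (Seq e (Deref (Loc k))))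
    by (intros e; apply fill_comp).
  unfold after_alloc. rewrite <- EK2. eapply conv_step; [apply HS_Fork|].
  rewrite EK2. apply (pure_step_conv _ _ _ _ _ _ (pure_step_seq UnitV _)).
  (* [g] is what remains of the writer, either [Unit] or the pending store; it sits idle at the end
     of the pool. *)
  assert (Weak : forall g u, agree_off k s u ->
            conv ((ts1 ++ fill K (Bool b) :: ts2) ++ [g]) u).
  { intros g u A. apply (HN k); auto; try lia.
    - now destruct ts1.
    - now rewrite app_nil_r. }
  destruct b.
  - rewrite app_comm_cons, app_assoc.
    eapply (conv_step _ KHole); [exact (HS_Store k (BoolV true) _ s1 F1)|].
    simpl. rewrite <- app_assoc; simpl.
    eapply conv_step; [apply HS_Deref, PositiveMap.gss|].
    rewrite app_nil_r. specialize (Weak Unit (PositiveMap.add k (BoolV true) s1)).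
    rewrite <- app_assoc in Weak. apply Weak.
    intros l Hl. rewrite PositiveMap.gso by auto. now apply A1.
  - eapply conv_step; [apply HS_Deref, F1|].
    rewrite app_nil_r. specialize (Weak (Store (Loc k) (Bool true)) s1).
    rewrite <- app_assoc in Weak. now apply Weak.
Qed.

Definition subst_closed (e : expr) : Prop := forall x v, subst x v e = e.

(** The empty predicate is among the [P], so no location occurs in [e]. *)
Definition loc_free (e : expr) : Prop := forall P, locs_in P e.

Lemma conv_choice e1 e2 ts1 K ts2 s :
  subst_closed e1 -> subst_closed e2 -> loc_free e1 -> loc_free e2 ->
  closed_config (ts1 ++ fill K Unit :: ts2) s ->
  conv (ts1 ++ fill K (choice e1 e2) :: ts2) s <->
  conv (ts1 ++ fill K e1 :: ts2) s \/ conv (ts1 ++ fill K e2 :: ts2) s.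
Proof.
  intros C1 C2 L1 L2 W. unfold choice.
  set (K1 := comp K (KAppL KHole (RecV BAnon BAnon e2))).
  assert (EK : forall e, fill K1 e = fill K (App e (Lam BAnon e2)))
    by (intros e; apply fill_comp).
  rewrite <- EK.
  etransitivity;
    [apply pure_step_conv; exact (pure_step_beta BAnon "t1" _ (RecV BAnon BAnon e1))|].
  simpl bsubst. rewrite EK.
  etransitivity;
    [apply pure_step_conv; exact (pure_step_beta BAnon "t2" _ (RecV BAnon BAnon e2))|].
  (* Substituting for [t2] traverses the thunk of [e1] that the first beta step has put in place. *)
  simpl bsubst. rewrite C1.
  set (K2 := comp K (KIf KHole (App (Lam BAnon e1) Unit) (App (Lam BAnon e2) Unit))).
  assert (EK2 : forall e, fill K2 e =
      fill K (If e (App (Lam BAnon e1) Unit) (App (Lam BAnon e2) Unit)))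
    by (intros e; apply fill_comp).
  assert (B : forall b, conv (ts1 ++ fill K2 (Bool b) :: ts2) s <->
                conv (ts1 ++ fill K (if b then e1 else e2) :: ts2) s).
  { intros b. rewrite EK2, (pure_step_conv _ _ _ _ _ _ (pure_step_if b _ _)).
    destruct b; apply pure_step_conv; exact (pure_step_beta BAnon BAnon _ UnitV). }
  assert (W2 : closed_config (ts1 ++ fill K2 Unit :: ts2) s).
  { rewrite EK2. apply closed_config_fill. simpl. auto. }
  transitivity (conv (ts1 ++ fill K2 (App rand Unit) :: ts2) s);
    [rewrite EK2; reflexivity|].
  split.
  - intros C. destruct (conv_rand_inv _ _ _ _ C W2) as [[] Hb]; apply B in Hb; auto.
  - intros [C|C]; [apply (conv_rand _ _ _ _ true)|apply (conv_rand _ _ _ _ false)];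
      now apply B.
Qed.

(** Such a pool may still converge when the main thread is another one. As [diverge] unfolds to
    itself, the moves of the others can be replayed next to any [e]. *)
Lemma conv_diverge_inv ts1 K ts2 s e :
  conv (ts1 ++ fill K diverge :: ts2) s -> conv (ts1 ++ fill K e :: ts2) s.
Proof.
  intros C.
  refine (conv_focus_ind (fun t => t = fill K diverge)
    (fun ts1 t ts2 s => conv (ts1 ++ fill K e :: ts2) s) _ _ _ _ _ _ _ _ eq_refl C);
    clear.
  - intros. constructor.
  - intros v ts2 s E. exfalso.
    destruct (fill_is_val K diverge) as [w Hw]; [now exists v|]. now destruct w.
  - intros; eapply conv_tp_step; eauto.
  - intros ts1 K0 e0 ts2 s e' s' efs E H C IH.
    destruct (fill_redex_unique _ _ _ _ _ _ _ _ (eq_sym E) H) as [-> ->].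
    { split; [now exists (RecV "f" "x" (App (Var "f") (Var "x")))|now exists UnitV]. }
    destruct (proj2 (pure_step_beta "f" "x" (App (Var "f") (Var "x")) UnitV) _ _ _ _ H)
      as (-> & -> & ->).
    rewrite app_nil_r in IH. now apply IH.
Qed.

(** * Runs of a sequence, and choices made after its first component *)

Lemma fill_seq_step_inv K e e2 K0 e0 s e0' s' efs :
  fill K (Seq e e2) = fill K0 e0 -> head_step e0 s e0' s' efs ->
  (exists v, e = of_val v /\ K0 = K /\ e0' = e2 /\ s' = s /\ efs = []) \/
  (exists K1, K0 = comp K (KAppR (Lam BAnon e2) K1) /\ e = fill K1 e0).
Proof.
  intros E H.
  destruct (fill_decompose _ _ _ _ _ _ _ _ E H) as (K1 & -> & E1).
  { intros [w Hw]. now destruct w. }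
  assert (N := head_step_not_val _ _ _ _ _ H).
  destruct K1; try discriminate; simpl in E1.
  - subst e0. destruct (head_step_redex_args _ _ _ _ _ H) as [_ [v ->]]. left.
    exists v. destruct (proj2 (pure_step_seq v e2) _ _ _ _ H) as (-> & -> & ->).
    repeat split; auto. clear; induction K; simpl; congruence.
  - exfalso. injection E1 as E1 _.
    apply N, (fill_is_val K1). exists (RecV BAnon BAnon e2). now symmetry.
  - right. injection E1 as E1 E2. subst. eauto.
Qed.

Lemma fill_seq_not_val K e e2 : ~ is_val (fill K (Seq e e2)).
Proof. intros H. destruct (fill_is_val _ _ H) as [w Hw]. now destruct w. Qed.

(* With [e2] a choice and [J] its two branches, this moves a choice made after the
   run of [e] before that run; with [e2] a branch and [J] the choice, back again. *)
Lemma conv_seq_replace (J : expr -> Prop) K e2 :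
  (forall ts1 ts2 s, closed_config (ts1 ++ fill K Unit :: ts2) s ->
     conv (ts1 ++ fill K e2 :: ts2) s ->
     exists f, J f /\ conv (ts1 ++ fill K f :: ts2) s) ->
  (exists f, J f) ->
  forall e ts1 ts2 s, closed_config (ts1 ++ fill K e :: ts2) s ->
  conv (ts1 ++ fill K (Seq e e2) :: ts2) s ->
  exists f, J f /\ conv (ts1 ++ fill K (Seq e f) :: ts2) s.
Proof.
  intros Hc [f0 Hf0] e ts1 ts2 s W C.
  refine (conv_focus_ind (fun t => exists e, t = fill K (Seq e e2))
    (fun ts1 t ts2 s => forall e, t = fill K (Seq e e2) ->
       closed_config (ts1 ++ fill K e :: ts2) s ->
       exists f, J f /\ conv (ts1 ++ fill K (Seq e f) :: ts2) s)
     _ _ _ _ _ _ _ _ (ex_intro _ e eq_refl) C e eq_refl W);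
    clear - Hc Hf0.
  (* The main thread finished before the sequence did, so any element of [J] will do; this is why
     [J] must be inhabited. *)
  - intros v ts1 t ts2 s _ e _ _. exists f0. split; auto. constructor.
  - intros v ts2 s _ e E _. exfalso.
    apply (fill_seq_not_val K e e2). now exists v.
  - intros ts1 t ts2 s ts1' ts2' s' _ H IH e -> W.
    destruct (IH e eq_refl (closed_config_step _ _ _ _ (H _) W)) as (f & Hf & Hb).
    exists f. split; auto. eapply conv_tp_step; [apply H|exact Hb].
  - intros ts1 K0 e0 ts2 s e' s' efs _ H C IH e E W.
    destruct (fill_seq_step_inv _ _ _ _ _ _ _ _ _ (eq_sym E) H)
      as [(v & -> & -> & -> & -> & ->)|(K1 & -> & ->)].
    (* The first component has become a value: [Hc] is applied in the pool and heap reached by now,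
       and the sequencing step is put back as a pure step. *)
    + rewrite app_nil_r in C. apply closed_config_fill in W as [W _].
      destruct (Hc _ _ _ W C) as (f & Hf & Cf). exists f. split; auto.
      now apply (pure_step_conv _ _ _ _ _ _ (pure_step_seq v f)).
    + rewrite fill_comp in IH. simpl in IH.
      destruct (IH (ex_intro _ (fill K1 e') eq_refl) _ eq_refl) as (f & Hf & Cf).
      * rewrite <- fill_comp in W |- *.
        eapply closed_config_step; [|exact W]. now constructor.
      * exists f. split; auto.
        change (Seq (fill K1 e0) f) with (fill (KAppR (Lam BAnon f) K1) e0).
        rewrite <- fill_comp.
        eapply conv_step; [exact H|]. now rewrite fill_comp.
Qed.

(** * Types and the typed congruence *)

Lemma ty_subst_ext s s' t : (forall i, s i = s' i) -> ty_subst s t = ty_subst s' t.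
Proof.
  revert s s'; induction t; simpl; intros s s' H; f_equal; auto;
    match goal with IH : forall s s', _ -> _ |- _ => apply IH end;
    intros []; simpl; auto; now rewrite H.
Qed.

Lemma ty_rename_subst r t : ty_rename r t = ty_subst (fun i => TVar (r i)) t.
Proof.
  revert r; induction t; simpl; intros r; f_equal; auto;
    match goal with IH : forall r, ty_rename r ?t = _ |- _ => rewrite IH end;
    apply ty_subst_ext; now intros [].
Qed.

Lemma ty_subst_rename s r t : ty_subst s (ty_rename r t) = ty_subst (fun i => s (r i)) t.
Proof.
  revert s r; induction t; simpl; intros s r; f_equal; auto;
    match goal with IH : forall s r, ty_subst s (ty_rename r ?t) = _ |- _ => rewrite IH end;
    apply ty_subst_ext; now intros [].
Qed.

Lemma ty_rename_rename r r' t :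
  ty_rename r' (ty_rename r t) = ty_rename (fun i => r' (r i)) t.
Proof. now rewrite ty_rename_subst, ty_subst_rename, ty_rename_subst. Qed.

Lemma ty_rename_ty_subst r s t :
  ty_rename r (ty_subst s t) = ty_subst (fun i => ty_rename r (s i)) t.
Proof.
  revert s r; induction t; simpl; intros s r; f_equal; auto;
    match goal with IH : forall s r, ty_rename r (ty_subst s ?t) = _ |- _ => rewrite IH end;
    apply ty_subst_ext; intros []; simpl; auto;
    unfold ty_shift; now rewrite !ty_rename_rename.
Qed.

Lemma ty_subst_subst s s' t :
  ty_subst s' (ty_subst s t) = ty_subst (fun i => ty_subst s' (s i)) t.
Proof.
  revert s s'; induction t; simpl; intros s s'; f_equal; auto;
    match goal with IH : forall s s', ty_subst s' (ty_subst s ?t) = _ |- _ => rewrite IH end;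
    apply ty_subst_ext; intros []; simpl; auto;
    unfold ty_shift; now rewrite ty_subst_rename, ty_rename_ty_subst.
Qed.

Lemma ty_subst_id t : ty_subst TVar t = t.
Proof.
  assert (H : forall s, (forall i, s i = TVar i) -> ty_subst s t = t); [|now apply H].
  induction t; simpl; intros s Hs; f_equal; auto;
    match goal with IH : forall s, _ -> _ |- _ => apply IH end;
    intros []; simpl; auto; now rewrite Hs.
Qed.

Definition inst_subst (u : ty) (i : nat) : ty := match i with 0 => u | S i => TVar i end.

Lemma ty_inst_shift u t : ty_subst (inst_subst u) (ty_shift t) = t.
Proof. unfold ty_shift. rewrite ty_subst_rename. apply ty_subst_id. Qed.

Lemma ty_subst_shift s t : ty_subst (up_subst s) (ty_shift t) = ty_shift (ty_subst s t).
Proof. unfold ty_shift. now rewrite ty_subst_rename, ty_rename_ty_subst. Qed.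

Lemma ty_subst_inst s t u :
  ty_subst s (ty_inst t u) = ty_inst (ty_subst (up_subst s) t) (ty_subst s u).
Proof.
  unfold ty_inst. rewrite !ty_subst_subst. apply ty_subst_ext.
  intros [|i]; simpl; auto. symmetry; apply (ty_inst_shift (ty_subst s u)).
Qed.

Definition sctx : Type := list (loc * ty).

Fixpoint slookup (Sg : sctx) (l : loc) : option ty :=
  match Sg with
  | [] => None
  | (k, t) :: Sg => if Pos.eqb l k then Some t else slookup Sg l
  end.

Definition map_snd {A} (f : ty -> ty) (G : list (A * ty)) : list (A * ty) :=
  map (fun p => (fst p, f (snd p))) G.

Lemma lookup_map f G x : lookup (map_snd f G) x = option_map f (lookup G x).
Proof.
  induction G as [|[y t] G IH]; simpl; auto. now destruct (String.eqb x y).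
Qed.

Lemma slookup_map f Sg l : slookup (map_snd f Sg) l = option_map f (slookup Sg l).
Proof.
  induction Sg as [|[y t] Sg IH]; simpl; auto. now destruct (Pos.eqb l y).
Qed.

Lemma bcons_map f b t G : map_snd f (bcons b t G) = bcons b (f t) (map_snd f G).
Proof. now destruct b. Qed.

Lemma map_snd_shift_subst {A} s (G : list (A * ty)) :
  map_snd ty_shift (map_snd (ty_subst s) G) =
  map_snd (ty_subst (up_subst s)) (map_snd ty_shift G).
Proof.
  unfold map_snd. rewrite !map_map. apply map_ext. intros []; simpl.
  now rewrite ty_subst_shift.
Qed.

Lemma map_snd_inst_shift {A} u (G : list (A * ty)) :
  map_snd (ty_subst (inst_subst u)) (map_snd ty_shift G) = G.
Proof.
  unfold map_snd. rewrite map_map. rewrite <- map_id. apply map_ext.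
  intros []; simpl. now rewrite ty_inst_shift.
Qed.

(* [rel B k Sg G e d t]: [e] and [d] are identical terms of type [t] up to
   subterms related by [B], which are closed and may be used at every instance of
   their type. For [k = false], [B] is not used at the root. Types need not be
   well formed; [Sg] types locations and is shifted under type binders. *)
Inductive rel (B : expr -> expr -> ty -> Prop) :
    bool -> sctx -> tctx -> expr -> expr -> ty -> Prop :=
| R_Var k Sg G x t : lookup G x = Some t -> rel B k Sg G (Var x) (Var x) t
| R_Loc k Sg G l t : slookup Sg l = Some t -> rel B k Sg G (Loc l) (Loc l) (TRef t)
| R_Unit k Sg G : rel B k Sg G Unit Unit TUnit
| R_Bool k Sg G b : rel B k Sg G (Bool b) (Bool b) TBool
| R_Int k Sg G n : rel B k Sg G (Int n) (Int n) TInt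
| R_UnOp k Sg G o e d t t' :
    unop_typed o t t' -> rel B true Sg G e d t -> rel B k Sg G (UnOp o e) (UnOp o d) t'
| R_BinOp k Sg G o e1 d1 e2 d2 t1 t2 t' :
    binop_typed o t1 t2 t' -> rel B true Sg G e1 d1 t1 -> rel B true Sg G e2 d2 t2 ->
    rel B k Sg G (BinOp o e1 e2) (BinOp o d1 d2) t'
| R_If k Sg G e d e1 d1 e2 d2 t :
    rel B true Sg G e d TBool -> rel B true Sg G e1 d1 t -> rel B true Sg G e2 d2 t ->
    rel B k Sg G (If e e1 e2) (If d d1 d2) t
| R_Pair k Sg G e1 d1 e2 d2 t1 t2 :
    rel B true Sg G e1 d1 t1 -> rel B true Sg G e2 d2 t2 ->
    rel B k Sg G (Pair e1 e2) (Pair d1 d2) (TProd t1 t2)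
| R_Fst k Sg G e d t1 t2 :
    rel B true Sg G e d (TProd t1 t2) -> rel B k Sg G (Fst e) (Fst d) t1
| R_Snd k Sg G e d t1 t2 :
    rel B true Sg G e d (TProd t1 t2) -> rel B k Sg G (Snd e) (Snd d) t2
| R_Inl k Sg G e d t1 t2 :
    rel B true Sg G e d t1 -> rel B k Sg G (Inl e) (Inl d) (TSum t1 t2)
| R_Inr k Sg G e d t1 t2 :
    rel B true Sg G e d t2 -> rel B k Sg G (Inr e) (Inr d) (TSum t1 t2)
| R_Match k Sg G e d x1 e1 d1 x2 e2 d2 t1 t2 t :
    rel B true Sg G e d (TSum t1 t2) ->
    rel B true Sg (bcons x1 t1 G) e1 d1 t -> rel B true Sg (bcons x2 t2 G) e2 d2 t ->
    rel B k Sg G (Match e x1 e1 x2 e2) (Match d x1 d1 x2 d2) t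
| R_Rec k Sg G f x e d t1 t2 :
    rel B true Sg (bcons x t1 (bcons f (TArrow t1 t2) G)) e d t2 ->
    rel B k Sg G (Rec f x e) (Rec f x d) (TArrow t1 t2)
| R_App k Sg G e1 d1 e2 d2 t1 t2 :
    rel B true Sg G e1 d1 (TArrow t1 t2) -> rel B true Sg G e2 d2 t1 ->
    rel B k Sg G (App e1 e2) (App d1 d2) t2
| R_TLam k Sg G e d t :
    rel B true (map_snd ty_shift Sg) (map_snd ty_shift G) e d t ->
    rel B k Sg G (TLam e) (TLam d) (TForall t)
| R_TApp k Sg G e d t u :
    rel B true Sg G e d (TForall t) -> rel B k Sg G (TApp e) (TApp d) (ty_inst t u)
| R_Pack k Sg G e d t u :
    rel B true Sg G e d (ty_inst t u) -> rel B k Sg G (Pack e) (Pack d) (TExists t)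
| R_Unpack k Sg G e1 d1 x e2 d2 t t' :
    rel B true Sg G e1 d1 (TExists t) ->
    rel B true (map_snd ty_shift Sg) (bcons x t (map_snd ty_shift G)) e2 d2 (ty_shift t') ->
    rel B k Sg G (Unpack e1 x e2) (Unpack d1 x d2) t'
| R_Fold k Sg G e d t :
    rel B true Sg G e d (ty_inst t (TMu t)) -> rel B k Sg G (Fold e) (Fold d) (TMu t)
| R_Unfold k Sg G e d t :
    rel B true Sg G e d (TMu t) -> rel B k Sg G (Unfold e) (Unfold d) (ty_inst t (TMu t))
| R_Ref k Sg G e d t :
    rel B true Sg G e d t -> rel B k Sg G (Ref e) (Ref d) (TRef t)
| R_Deref k Sg G e d t :
    rel B true Sg G e d (TRef t) -> rel B k Sg G (Deref e) (Deref d) t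
| R_Store k Sg G e1 d1 e2 d2 t :
    rel B true Sg G e1 d1 (TRef t) -> rel B true Sg G e2 d2 t ->
    rel B k Sg G (Store e1 e2) (Store d1 d2) TUnit
| R_CAS k Sg G e1 d1 e2 d2 e3 d3 t :
    cas_ty t -> rel B true Sg G e1 d1 (TRef t) ->
    rel B true Sg G e2 d2 t -> rel B true Sg G e3 d3 t ->
    rel B k Sg G (CAS e1 e2 e3) (CAS d1 d2 d3) TBool
| R_Fork k Sg G e d :
    rel B true Sg G e d TUnit -> rel B k Sg G (Fork e) (Fork d) TUnit
| R_Base Sg G a b t s : B a b t -> rel B true Sg G a b (ty_subst s t).

Lemma rel_true B k Sg G e d t : rel B k Sg G e d t -> rel B true Sg G e d t.
Proof. destruct 1; econstructor; eauto. Qed.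

Lemma rel_mono (B B' : expr -> expr -> ty -> Prop) k Sg G e d t :
  (forall e d t, B e d t -> B' e d t) -> rel B k Sg G e d t -> rel B' k Sg G e d t.
Proof. intros H; induction 1; econstructor; eauto. Qed.

Lemma typed_rel B Xi G e t : typed Xi G e t -> forall k Sg, rel B k Sg G e e t.
Proof. induction 1; intros; econstructor; eauto. Qed.

(** * Type substitution, weakening and term substitution for the congruence *)

Lemma unop_typed_subst s o t t' :
  unop_typed o t t' -> unop_typed o (ty_subst s t) (ty_subst s t').
Proof. destruct 1; constructor. Qed.

Lemma binop_typed_subst s o t1 t2 t' :
  binop_typed o t1 t2 t' ->
  binop_typed o (ty_subst s t1) (ty_subst s t2) (ty_subst s t').
Proof. destruct 1; constructor. Qed.

Lemma cas_ty_subst s t : cas_ty t -> cas_ty (ty_subst s t).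
Proof. destruct 1; constructor. Qed.

(** Needed when a type abstraction is applied or a package opened: the body was related at a type
    variable. Base pairs survive because [R_Base] admits every type instance. *)
Lemma rel_ty_subst B k Sg G e d t : rel B k Sg G e d t -> forall s,
  rel B k (map_snd (ty_subst s) Sg) (map_snd (ty_subst s) G) e d (ty_subst s t).
Proof.
  induction 1; intros s0;
    try (simpl in *; econstructor;
      eauto using unop_typed_subst, binop_typed_subst, cas_ty_subst; fail);
    try (specialize (IHrel s0); simpl in IHrel; econstructor; eauto; fail).
  - constructor. rewrite lookup_map. now rewrite H.
  - simpl. constructor. rewrite slookup_map. now rewrite H.
  - econstructor; eauto; [specialize (IHrel2 s0)|specialize (IHrel3 s0)];
      rewrite bcons_map in *; eauto.
  - simpl. constructor. specialize (IHrel s0). now rewrite !bcons_map in IHrel.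
  - simpl. constructor. rewrite !map_snd_shift_subst. apply IHrel.
  - rewrite ty_subst_inst. econstructor. apply (IHrel s0).
  - simpl. econstructor. specialize (IHrel s0). rewrite ty_subst_inst in IHrel.
    exact IHrel.
  - econstructor; [apply (IHrel1 s0)|]. rewrite !map_snd_shift_subst, <- bcons_map.
    rewrite <- ty_subst_shift. apply IHrel2.
  - simpl. econstructor. specialize (IHrel s0). rewrite ty_subst_inst in IHrel.
    exact IHrel.
  - rewrite ty_subst_inst. econstructor. apply (IHrel s0).
  - exact (R_CAS _ _ _ _ _ _ _ _ _ _ _ (cas_ty_subst s0 _ H) (IHrel1 s0) (IHrel2 s0) (IHrel3 s0)).
  - rewrite ty_subst_subst. now constructor.
Qed.

(** Inclusion of contexts as finite maps, so that weakening also drops shadowed entries and reorders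
    bindings. *)
Definition sub_lookup (G G' : tctx) : Prop :=
  forall x t, lookup G x = Some t -> lookup G' x = Some t.

Definition sub_slookup (Sg Sg' : sctx) : Prop :=
  forall l t, slookup Sg l = Some t -> slookup Sg' l = Some t.

Lemma sub_lookup_bcons b t G G' :
  sub_lookup G G' -> sub_lookup (bcons b t G) (bcons b t G').
Proof. destruct b as [|y]; auto. intros H x u; simpl. destruct (String.eqb x y); auto. Qed.

Lemma sub_lookup_map f G G' :
  sub_lookup G G' -> sub_lookup (map_snd f G) (map_snd f G').
Proof.
  intros H x t. rewrite !lookup_map.
  destruct (lookup G x) eqn:E; [|easy]. now rewrite (H _ _ E).
Qed.

Lemma sub_slookup_map f Sg Sg' :
  sub_slookup Sg Sg' -> sub_slookup (map_snd f Sg) (map_snd f Sg').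
Proof.
  intros H x t. rewrite !slookup_map.
  destruct (slookup Sg x) eqn:E; [|easy]. now rewrite (H _ _ E).
Qed.

Lemma rel_weaken B k Sg G e d t : rel B k Sg G e d t -> forall Sg' G',
  sub_slookup Sg Sg' -> sub_lookup G G' -> rel B k Sg' G' e d t.
Proof.
  induction 1; intros;
    econstructor; eauto using sub_lookup_bcons, sub_lookup_map, sub_slookup_map.
Qed.

Lemma rel_weaken_store B k Sg Sg' G e d t :
  sub_slookup Sg Sg' -> rel B k Sg G e d t -> rel B k Sg' G e d t.
Proof. intros H R. eapply rel_weaken; eauto. now intros x u. Qed.

Definition closed_base (B : expr -> expr -> ty -> Prop) : Prop :=
  forall a b t, B a b t -> subst_closed a /\ subst_closed b.

Definition lookup_except (x : string) (G G' : tctx) : Prop :=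
  forall y t, y <> x -> lookup G y = Some t -> lookup G' y = Some t.

Lemma lookup_except_bcons x b t G G' :
  lookup_except x G G' -> lookup_except x (bcons b t G) (bcons b t G').
Proof.
  destruct b as [|z]; auto. intros H y u N; simpl. destruct (String.eqb y z); auto.
Qed.

Lemma binds_spec b x : binds b x = true -> b = BNamed x.
Proof. destruct b; [easy|]. simpl. intros E. apply String.eqb_eq in E. now subst. Qed.

Lemma lookup_bcons_other b t G x :
  binds b x = false -> lookup (bcons b t G) x = lookup G x.
Proof. destruct b; simpl; auto. rewrite String.eqb_sym. now intros ->. Qed.

Lemma lookup_except_binds x b t G G' :
  binds b x = true -> lookup_except x G G' -> sub_lookup (bcons b t G) (bcons b t G').
Proof.
  intros E H y u. apply binds_spec in E as ->. simpl.
  destruct (String.eqb y x) eqn:E; auto. apply String.eqb_neq in E. auto.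
Qed.

Lemma lookup_except_map f x G G' :
  lookup_except x G G' -> lookup_except x (map_snd f G) (map_snd f G').
Proof.
  intros H y t N. rewrite !lookup_map.
  destruct (lookup G y) eqn:E; [|easy]. now rewrite (H _ _ N E).
Qed.

Lemma rel_shift_closed B k Sg e d t :
  rel B k Sg [] e d t -> rel B k (map_snd ty_shift Sg) [] e d (ty_shift t).
Proof.
  intros H. apply rel_ty_subst with (s := fun i => TVar (S i)) in H.
  unfold ty_shift. rewrite ty_rename_subst.
  replace (map_snd (ty_rename S) Sg)
    with (map_snd (ty_subst (fun i => TVar (S i))) Sg); [exact H|].
  apply map_ext. intros []; simpl. now rewrite ty_rename_subst.
Qed.

(** * Simulation *)

(** Capture cannot occur, as [v] and [w] are related in the empty context; base pairs are left
    unchanged because they are closed. *)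
Lemma rel_subst B k Sg G e d t :
  closed_base B -> rel B k Sg G e d t -> forall x v w tx G',
  rel B true Sg [] v w tx -> lookup G x = Some tx -> lookup_except x G G' ->
  rel B true Sg G' (subst x v e) (subst x w d) t.
Proof.
  intros HB; induction 1; intros y v w ty G' Hv Hl Hx; simpl;
    try (econstructor; eauto; fail).
  - destruct (String.eqb y x) eqn:E.
    + apply String.eqb_eq in E as ->. rewrite H in Hl; injection Hl as ->.
      eapply rel_weaken; eauto; now intros ? ?.
    + constructor. apply String.eqb_neq in E. apply Hx; auto.
  - econstructor; eauto.
    + destruct (binds x1 y) eqn:E.
      * eapply rel_weaken; eauto using lookup_except_binds. now intros ? ?.
      * eapply IHrel2; eauto using lookup_except_bcons. now rewrite lookup_bcons_other.
    + destruct (binds x2 y) eqn:E.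
      * eapply rel_weaken; eauto using lookup_except_binds. now intros ? ?.
      * eapply IHrel3; eauto using lookup_except_bcons. now rewrite lookup_bcons_other.
  - constructor. destruct (binds f y) eqn:Ef; simpl.
    + eapply rel_weaken; eauto using sub_lookup_bcons, lookup_except_binds.
      now intros ? ?.
    + destruct (binds x y) eqn:Ex.
      * eapply rel_weaken; eauto using lookup_except_bcons, lookup_except_binds.
        now intros ? ?.
      * eapply IHrel; eauto using lookup_except_bcons.
        now rewrite !lookup_bcons_other.
  - constructor. eapply IHrel; eauto using rel_shift_closed, lookup_except_map.
    now rewrite lookup_map, Hl.
  - econstructor; eauto. destruct (binds x y) eqn:E.
    + eapply rel_weaken; eauto using lookup_except_binds, lookup_except_map.
      now intros ? ?.
    + eapply IHrel2;
        eauto using lookup_except_bcons, rel_shift_closed, lookup_except_map.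
      now rewrite lookup_bcons_other, lookup_map, Hl.
  - destruct (HB _ _ _ H) as [Ca Cb]. rewrite Ca, Cb. now constructor.
Qed.

Lemma rel_bsubst B Sg G x e d t tx v w :
  closed_base B -> rel B true Sg (bcons x tx G) e d t -> rel B true Sg [] v w tx ->
  rel B true Sg G (bsubst x v e) (bsubst x w d) t.
Proof.
  intros HB He Hv. destruct x as [|x]; simpl in *; auto.
  eapply rel_subst; eauto; simpl.
  - now rewrite String.eqb_refl.
  - intros y u N. simpl. apply String.eqb_neq in N. now rewrite N.
Qed.

Lemma rel_loc_free B k Sg G e d t :
  (forall a b t, B a b t -> loc_free b) -> rel B k Sg G e d t -> forall P,
  (forall l t, slookup Sg l = Some t -> P l) -> locs_in P d.
Proof.
  intros HB; induction 1; intros P HP; simpl; auto; eauto.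
  - apply IHrel. intros l u. rewrite slookup_map.
    destruct (slookup Sg l) eqn:E; [|easy]. eauto.
  - split; auto. apply IHrel2. intros l u. rewrite slookup_map.
    destruct (slookup Sg l) eqn:E; [|easy]. eauto.
  - now apply (HB _ _ _ H).
Qed.

(* The first clause transfers closedness of configurations from [d] to [e]. *)
Definition ciu_le (e d : expr) : Prop :=
  (forall P, locs_in P d -> locs_in P e) /\
  forall ts1 K ts2 s, closed_config (ts1 ++ fill K d :: ts2) s ->
    conv (ts1 ++ fill K e :: ts2) s -> conv (ts1 ++ fill K d :: ts2) s.

Lemma ciu_le_refl e : ciu_le e e.
Proof. split; auto. Qed.

Lemma ciu_le_trans e1 e2 e3 : ciu_le e1 e2 -> ciu_le e2 e3 -> ciu_le e1 e3.
Proof.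
  intros [L1 C1] [L2 C2]; split; auto. intros ts1 K ts2 s W C.
  apply C2; auto. apply C1; auto.
  apply closed_config_fill in W. apply closed_config_fill. intuition.
Qed.

Lemma ciu_le_fill K e d : ciu_le e d -> ciu_le (fill K e) (fill K d).
Proof.
  intros [L C]; split.
  - intros P. rewrite (locs_in_fill P K d), (locs_in_fill P K e). intuition.
  - intros ts1 K' ts2 s. rewrite <- !fill_comp. apply C.
Qed.

(** The self-relation of [a] avoids [B] at the root: once [b] has been replaced by [a], both sides
    show the same outermost constructor. *)
Definition good_base (B : expr -> expr -> ty -> Prop) : Prop :=
  forall a b t, B a b t ->
    subst_closed a /\ subst_closed b /\ loc_free b /\
    rel B false [] [] a a t /\ ciu_le a b.

Section Good.
Context (B : expr -> expr -> ty -> Prop) (HB : good_base B).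

Lemma good_base_closed : closed_base B.
Proof. intros a b t H. destruct (HB _ _ _ H) as (? & ? & _). auto. Qed.

(** If the root is an instance of a base pair, the right side is exchanged for the left one;
    otherwise it is kept. *)
Lemma rel_root k Sg G e d t :
  rel B k Sg G e d t -> exists d', rel B false Sg G e d' t /\ ciu_le d' d.
Proof.
  intros H. assert (E : rel B false Sg G e d t \/ exists s t0, B e d t0 /\ t = ty_subst s t0).
  { destruct H; try (left; econstructor; eauto; fail). right; eauto. }
  destruct E as [E|(s & t0 & E & ->)].
  - exists d. auto using ciu_le_refl.
  - exists e. destruct (HB _ _ _ E) as (_ & _ & _ & R & C). split; auto.
    apply rel_ty_subst with (s := s) in R.
    eapply rel_weaken; [exact R|now intros ? ?|now intros ? ?].
Qed.

(** Bodies of functions are not compared. On values of the types that [CAS] and the operators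
    inspect, this is equality. *)
Fixpoint same_shape (v w : val) : Prop :=
  match v, w with
  | UnitV, UnitV | RecV _ _ _, RecV _ _ _ | TLamV _, TLamV _ => True
  | BoolV b, BoolV c => b = c
  | IntV m, IntV n => m = n
  | LocV l, LocV k => l = k
  | PairV v1 v2, PairV w1 w2 => same_shape v1 w1 /\ same_shape v2 w2
  | InlV v, InlV w | InrV v, InrV w | PackV v, PackV w | FoldV v, FoldV w =>
      same_shape v w
  | _, _ => False
  end.

Ltac inv H := inversion H; clear H; subst.

Ltac root H :=
  let d := fresh "d" in let R := fresh "R" in let C := fresh "C" in
  destruct (rel_root _ _ _ _ _ _ H) as (d & R & C); clear H; simpl in R; inv R.

(** [d] itself may still have to run, as [e ⊕ e] does when it faces a value [e]. Replacing base
    pairs at the root, and then inside the components, turns it into a value. *)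
Lemma rel_val Sg v d t :
  rel B true Sg [] (of_val v) d t ->
  exists w, ciu_le (of_val w) d /\ same_shape v w /\
    rel B true Sg [] (of_val v) (of_val w) t.
Proof.
  revert d t; induction v; simpl; intros d0 t0 H; root H.
  - exists UnitV. split; [|split]; simpl; auto. constructor.
  - exists (BoolV b). split; [|split]; simpl; auto. constructor.
  - exists (IntV n). split; [|split]; simpl; auto. constructor.
  - exists (LocV l). split; [|split]; simpl; auto. now constructor.
  - edestruct IHv1 as (w1 & C1 & S1 & R1); [eassumption|].
    edestruct IHv2 as (w2 & C2 & S2 & R2); [eassumption|].
    exists (PairV w1 w2). split; [|split]; simpl; auto; [|now constructor].
    (* The left component may be replaced only next to the value [w2], since pairs are evaluated
       from right to left. *)
    eapply ciu_le_trans; [apply (ciu_le_fill (KPairL KHole w2)), C1|].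
    eapply ciu_le_trans; [apply (ciu_le_fill (KPairR _ KHole)), C2|exact C].
  - edestruct IHv as (w & C1 & S1 & R1); [eassumption|].
    exists (InlV w). split; [|split]; simpl; auto; [|now constructor].
    eapply ciu_le_trans; [apply (ciu_le_fill (KInl KHole)), C1|exact C].
  - edestruct IHv as (w & C1 & S1 & R1); [eassumption|].
    exists (InrV w). split; [|split]; simpl; auto; [|now constructor].
    eapply ciu_le_trans; [apply (ciu_le_fill (KInr KHole)), C1|exact C].
  - eexists (RecV f x _). split; [exact C|split]; simpl; auto. now constructor.
  - eexists (TLamV _). split; [exact C|split]; simpl; auto. now constructor.
  - edestruct IHv as (w & C1 & S1 & R1); [eassumption|].
    exists (PackV w). split; [|split]; simpl; auto; [|now econstructor; eauto].
    eapply ciu_le_trans; [apply (ciu_le_fill (KPack KHole)), C1|exact C].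
  - edestruct IHv as (w & C1 & S1 & R1); [eassumption|].
    exists (FoldV w). split; [|split]; simpl; auto; [|now constructor].
    eapply ciu_le_trans; [apply (ciu_le_fill (KFold KHole)), C1|exact C].
Qed.

Ltac val H :=
  let w := fresh "w" in let C := fresh "Cw" in let S := fresh "Sw" in
  let R := fresh "Rw" in
  destruct (rel_val _ _ _ _ H) as (w & C & S & R); clear H.

(** Exchanges arguments one at a time; an argument is in evaluation position only once those to its
    right are values. *)
Ltac ciu :=
  simpl;
  match goal with
  | H : ?P |- ?P => exact H
  | |- ciu_le ?x ?x => apply ciu_le_refl
  | |- ciu_le (UnOp ?o _) (UnOp ?o _) => apply (ciu_le_fill (KUnOp o KHole)); ciu
  | |- ciu_le (BinOp ?o ?x _) (BinOp ?o ?x _) =>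
      apply (ciu_le_fill (KBinOpR o x KHole)); ciu
  | |- ciu_le (BinOp ?o _ (of_val ?w)) (BinOp ?o ?y _) =>
      apply (ciu_le_trans _ (BinOp o y (of_val w)));
      [apply (ciu_le_fill (KBinOpL o KHole w)); ciu|ciu]
  | |- ciu_le (If _ ?x ?y) (If _ ?x ?y) => apply (ciu_le_fill (KIf KHole x y)); ciu
  | |- ciu_le (Pair ?x _) (Pair ?x _) => apply (ciu_le_fill (KPairR x KHole)); ciu
  | |- ciu_le (Pair _ (of_val ?w)) (Pair ?y _) =>
      apply (ciu_le_trans _ (Pair y (of_val w)));
      [apply (ciu_le_fill (KPairL KHole w)); ciu|ciu]
  | |- ciu_le (Fst _) (Fst _) => apply (ciu_le_fill (KFst KHole)); ciu
  | |- ciu_le (Snd _) (Snd _) => apply (ciu_le_fill (KSnd KHole)); ciu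
  | |- ciu_le (Inl _) (Inl _) => apply (ciu_le_fill (KInl KHole)); ciu
  | |- ciu_le (Inr _) (Inr _) => apply (ciu_le_fill (KInr KHole)); ciu
  | |- ciu_le (Match _ ?x1 ?e1 ?x2 ?e2) (Match _ _ _ _ _) =>
      apply (ciu_le_fill (KMatch KHole x1 e1 x2 e2)); ciu
  | |- ciu_le (App ?x _) (App ?x _) => apply (ciu_le_fill (KAppR x KHole)); ciu
  | |- ciu_le (App _ (of_val ?w)) (App ?y _) =>
      apply (ciu_le_trans _ (App y (of_val w)));
      [apply (ciu_le_fill (KAppL KHole w)); ciu|ciu]
  | |- ciu_le (TApp _) (TApp _) => apply (ciu_le_fill (KTApp KHole)); ciu
  | |- ciu_le (Pack _) (Pack _) => apply (ciu_le_fill (KPack KHole)); ciu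
  | |- ciu_le (Unpack _ ?x ?e) (Unpack _ _ _) =>
      apply (ciu_le_fill (KUnpack KHole x e)); ciu
  | |- ciu_le (Fold _) (Fold _) => apply (ciu_le_fill (KFold KHole)); ciu
  | |- ciu_le (Unfold _) (Unfold _) => apply (ciu_le_fill (KUnfold KHole)); ciu
  | |- ciu_le (Ref _) (Ref _) => apply (ciu_le_fill (KRef KHole)); ciu
  | |- ciu_le (Deref _) (Deref _) => apply (ciu_le_fill (KDeref KHole)); ciu
  | |- ciu_le (Store ?x _) (Store ?x _) => apply (ciu_le_fill (KStoreR x KHole)); ciu
  | |- ciu_le (Store _ (of_val ?w)) (Store ?y _) =>
      apply (ciu_le_trans _ (Store y (of_val w)));
      [apply (ciu_le_fill (KStoreL KHole w)); ciu|ciu]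
  | |- ciu_le (CAS ?x ?y _) (CAS ?x ?y _) => apply (ciu_le_fill (KCASR x y KHole)); ciu
  | |- ciu_le (CAS ?x _ (of_val ?w)) (CAS ?x ?y _) =>
      apply (ciu_le_trans _ (CAS x y (of_val w)));
      [apply (ciu_le_fill (KCASM x KHole w)); ciu|ciu]
  | |- ciu_le (CAS _ (of_val ?v) (of_val ?w)) (CAS ?x ?y ?z) =>
      apply (ciu_le_trans _ (CAS x (of_val v) (of_val w)));
      [apply (ciu_le_fill (KCASL KHole v w)); ciu|ciu]
  | C : ciu_le ?x ?d |- ciu_le _ ?d => apply (ciu_le_trans _ x); [ciu|exact C]
  end.

Ltac vals := repeat match goal with
  | H : rel B true _ [] (of_val _) ?d _ |- _ =>
      lazymatch d with of_val _ => fail | _ => val H end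
  end.

(** [D] decomposes like the left side only after replacing the base pairs on the path to the hole
    and those among the arguments already evaluated on the left. The last clause rebuilds the thread
    after a step, possibly over a larger store typing. *)
Lemma rel_fill K Sg e D t :
  rel B true Sg [] (fill K e) D t ->
  exists K' d t', rel B true Sg [] e d t' /\ ciu_le (fill K' d) D /\
    forall Sg' e' d', sub_slookup Sg Sg' -> rel B true Sg' [] e' d' t' ->
      rel B true Sg' [] (fill K e') (fill K' d') t.
Proof.
  revert D t; induction K; simpl; intros D t0 H;
    [exists KHole, D, t0; split; [exact H|split; [apply ciu_le_refl|auto]]|..];
    root H;
    vals;
    match goal with
    | IH : forall D t, rel B true Sg [] (fill ?K e) D t -> _,
      H : rel B true Sg [] (fill ?K e) _ _ |- _ =>
        destruct (IH _ _ H) as (K' & d' & t' & R & C1 & F); clear IH H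
    end.
  all: match goal with
  | |- context [UnOp ?o _] => exists (KUnOp o K')
  | w : val, C : ciu_le (of_val ?w) _ |- context [BinOp ?o (fill _ _) (of_val _)] =>
      exists (KBinOpL o K' w)
  | |- context [BinOp ?o _ (fill _ _)] => eexists (KBinOpR o _ K')
  | |- context [If _ _ _] => eexists (KIf K' _ _)
  | C : ciu_le (of_val ?w) _ |- context [Pair (fill _ _) (of_val _)] => exists (KPairL K' w)
  | |- context [Pair _ (fill _ _)] => eexists (KPairR _ K')
  | |- context [Fst _] => exists (KFst K')
  | |- context [Snd _] => exists (KSnd K')
  | |- context [Inl _] => exists (KInl K')
  | |- context [Inr _] => exists (KInr K')
  | |- context [Match _ ?x1 _ ?x2 _] => eexists (KMatch K' x1 _ x2 _)
  | C : ciu_le (of_val ?w) _ |- context [App (fill _ _) (of_val _)] => exists (KAppL K' w)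
  | |- context [App _ (fill _ _)] => eexists (KAppR _ K')
  | |- context [TApp _] => exists (KTApp K')
  | |- context [Pack _] => exists (KPack K')
  | |- context [Unpack _ ?x _] => eexists (KUnpack K' x _)
  | |- context [Fold _] => exists (KFold K')
  | |- context [Unfold _] => exists (KUnfold K')
  | |- context [Ref _] => exists (KRef K')
  | |- context [Deref _] => exists (KDeref K')
  | C : ciu_le (of_val ?w) _ |- context [Store (fill _ _) (of_val _)] => exists (KStoreL K' w)
  | |- context [Store _ (fill _ _)] => eexists (KStoreR _ K')
  | C : ciu_le (of_val ?w2) ?d2, C' : ciu_le (of_val ?w3) ?d3,
    _ : ciu_le (CAS _ ?d2 ?d3) _
    |- context [CAS (fill _ _) (of_val _) (of_val _)] => exists (KCASL K' w2 w3)
  | C : ciu_le (of_val ?w) _ |- context [CAS _ (fill _ _) (of_val _)] => eexists (KCASM _ K' w)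
  | |- context [CAS _ _ (fill _ _)] => eexists (KCASR _ _ K')
  end; exists d', t'; split; [exact R|].
  all: split; [|simpl; intros; econstructor;
                 eauto using rel_weaken_store, sub_slookup_map].
  all: ciu.
Qed.

(** Equal domains let both runs allocate the same location, so no renaming of locations is needed
    and comparisons of references agree. *)
Definition heap_rel (Sg : sctx) (s u : state) : Prop :=
  forall l, match slookup Sg l with
  | None => find l s = None /\ find l u = None
  | Some t => exists v w, find l s = Some v /\ find l u = Some w /\
      same_shape v w /\ rel B true Sg [] (of_val v) (of_val w) t
  end.

Lemma heap_rel_update Sg s u l t v w :
  heap_rel Sg s u -> slookup Sg l = Some t ->
  same_shape v w -> rel B true Sg [] (of_val v) (of_val w) t ->
  heap_rel Sg (PositiveMap.add l v s) (PositiveMap.add l w u).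
Proof.
  intros H E Sh R k. destruct (Pos.eq_dec k l) as [->|N].
  - rewrite E, !PositiveMap.gss. eauto 6.
  - rewrite !PositiveMap.gso by auto. apply H.
Qed.

Lemma heap_rel_alloc Sg s u l t v w :
  heap_rel Sg s u -> find l s = None ->
  same_shape v w -> rel B true Sg [] (of_val v) (of_val w) t ->
  sub_slookup Sg ((l, t) :: Sg) /\ find l u = None /\
  heap_rel ((l, t) :: Sg) (PositiveMap.add l v s) (PositiveMap.add l w u).
Proof.
  intros H E Sh R. assert (Hl := H l).
  destruct (slookup Sg l) eqn:El; [destruct Hl as (? & ? & ? & _); congruence|].
  assert (Sub : sub_slookup Sg ((l, t) :: Sg)).
  { intros k t' Hk. simpl. destruct (Pos.eqb_spec k l); congruence. }
  split; [exact Sub|split; [tauto|]]. intros k. simpl.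
  destruct (Pos.eqb_spec k l) as [->|N].
  - rewrite !PositiveMap.gss. eauto 7 using rel_weaken_store.
  - rewrite !PositiveMap.gso by auto. assert (Hk := H k).
    destruct (slookup Sg k); auto. destruct Hk as (v' & w' & ? & ? & ? & ?).
    exists v', w'. eauto using rel_weaken_store.
Qed.

Definition base_val (v : val) : Prop :=
  match v with UnitV | BoolV _ | IntV _ | LocV _ => True | _ => False end.

Lemma rel_cas_base Sg v d t :
  cas_ty t -> rel B true Sg [] (of_val v) d t -> base_val v.
Proof.
  intros Ct H. root H; destruct v; simpl; auto; try discriminate; inversion Ct.
Qed.

Lemma same_shape_base_l v w : base_val v -> same_shape v w -> w = v.
Proof. destruct v, w; simpl; intros; subst; tauto. Qed.

Lemma same_shape_base_r v w : base_val w -> same_shape v w -> v = w.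
Proof. destruct v, w; simpl; intros; subst; tauto. Qed.

Lemma unop_typed_cas o t t' : unop_typed o t t' -> cas_ty t.
Proof. destruct 1; constructor. Qed.

Lemma binop_typed_cas o t1 t2 t' : binop_typed o t1 t2 t' -> cas_ty t1 /\ cas_ty t2.
Proof. destruct 1; split; constructor. Qed.

Lemma unop_eval_rel o t t' v v' Sg :
  unop_typed o t t' -> unop_eval o v = Some v' ->
  rel B true Sg [] (of_val v') (of_val v') t'.
Proof.
  destruct 1, v; simpl; try discriminate; intros [= <-]; constructor.
Qed.

Lemma binop_eval_rel o t1 t2 t' v1 v2 v' Sg :
  binop_typed o t1 t2 t' -> binop_eval o v1 v2 = Some v' ->
  rel B true Sg [] (of_val v') (of_val v') t'.
Proof.
  destruct 1, v1, v2; simpl; try discriminate; intros [= <-]; constructor.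
Qed.

Ltac pure_case d2 d' u Sg :=
  exists d2, d', u, [], Sg;
  split; [ciu|split; [|split; [assumption|split; [|split; [assumption|constructor]]]]].

(** Once replacements have exposed a redex of the same form with related values, the right side
    takes the same rule; the store typing grows only at an allocation. *)
Lemma rel_head_step e s e' s' efs Sg d t u :
  head_step e s e' s' efs -> rel B true Sg [] e d t -> heap_rel Sg s u ->
  exists d2 d' u' dfs Sg',
    ciu_le d2 d /\ head_step d2 u d' u' dfs /\ sub_slookup Sg Sg' /\
    rel B true Sg' [] e' d' t /\ heap_rel Sg' s' u' /\
    Forall2 (fun e d => exists t, rel B true Sg' [] e d t) efs dfs.
Proof.
  intros H R Hh. assert (Sub : sub_slookup Sg Sg) by now intros ? ?.
  assert (Cl := good_base_closed).
  destruct H; root R; vals.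
  all: try match goal with
       | H : rel B true _ [] (Pair _ _) _ _ |- _ => root H; vals
       | H : rel B true _ [] (Inl _) _ _ |- _ => root H; vals
       | H : rel B true _ [] (Inr _) _ _ |- _ => root H; vals
       | H : rel B true _ [] (Rec _ _ _) _ _ |- _ => root H
       | H : rel B true _ [] (TLam _) _ _ |- _ => root H
       | H : rel B true _ [] (Pack _) _ _ |- _ => root H; vals
       | H : rel B true _ [] (Fold _) _ _ |- _ => root H; vals
       | H : rel B true _ [] (Loc _) _ _ |- _ => root H
       | H : rel B true _ [] (Bool _) _ _ |- _ => root H
       end.
  - match goal with T : unop_typed _ _ _, R : rel _ _ _ _ _ (of_val ?w) _ |- _ =>
      assert (w = v) as -> by
        eauto using same_shape_base_l, rel_cas_base, unop_typed_cas;
      pure_case (UnOp o (of_val v)) (of_val v') u Sg;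
      [now constructor|eapply unop_eval_rel; eauto]
    end.
  - match goal with T : binop_typed _ _ _ _,
      S1 : same_shape v1 ?w1, S2 : same_shape v2 ?w2 |- _ =>
      destruct (binop_typed_cas _ _ _ _ T);
      assert (w1 = v1) as -> by eauto using same_shape_base_l, rel_cas_base;
      assert (w2 = v2) as -> by eauto using same_shape_base_l, rel_cas_base;
      pure_case (BinOp o (of_val v1) (of_val v2)) (of_val v') u Sg;
      [now constructor|eapply binop_eval_rel; eauto]
    end.
  - match goal with R : rel _ _ _ _ e1 ?d1 _, R' : rel _ _ _ _ e2 ?d2 _ |- _ =>
      pure_case (If (Bool true) d1 d2) d1 u Sg; [constructor|assumption]
    end.
  - match goal with R : rel _ _ _ _ e1 ?d1 _, R' : rel _ _ _ _ e2 ?d2 _ |- _ =>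
      pure_case (If (Bool false) d1 d2) d2 u Sg; [constructor|assumption]
    end.
  - match goal with S1 : same_shape v1 ?w1, S2 : same_shape v2 ?w2 |- _ =>
      pure_case (Fst (Pair (of_val w1) (of_val w2))) (of_val w1) u Sg;
      [constructor|assumption]
    end.
  - match goal with S1 : same_shape v1 ?w1, S2 : same_shape v2 ?w2 |- _ =>
      pure_case (Snd (Pair (of_val w1) (of_val w2))) (of_val w2) u Sg;
      [constructor|assumption]
    end.
  - match goal with S1 : same_shape v ?w,
      R : rel _ _ _ _ e1 ?d1 _, R' : rel _ _ _ _ e2 ?d2 _ |- _ =>
      pure_case (Match (Inl (of_val w)) x1 d1 x2 d2) (bsubst x1 (of_val w) d1) u Sg;
      [constructor|eapply rel_bsubst; eauto]
    end.
  - match goal with S1 : same_shape v ?w,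
      R : rel _ _ _ _ e1 ?d1 _, R' : rel _ _ _ _ e2 ?d2 _ |- _ =>
      pure_case (Match (Inr (of_val w)) x1 d1 x2 d2) (bsubst x2 (of_val w) d2) u Sg;
      [constructor|eapply rel_bsubst; eauto]
    end.
  - match goal with S1 : same_shape v ?w, R : rel _ _ _ _ e ?d0 _ |- _ =>
      pure_case (App (Rec f x d0) (of_val w))
        (bsubst f (Rec f x d0) (bsubst x (of_val w) d0)) u Sg;
      [constructor|eapply rel_bsubst; [auto|eapply rel_bsubst; eauto|constructor; exact R]]
    end.
  (* The body is related under one more type variable. Instantiating it cancels the shift of the
     store typing, which holds for the opened package below as well. *)
  - match goal with R : rel _ _ (map_snd _ _) _ e ?d0 _ |- _ =>
      pure_case (TApp (TLam d0)) d0 u Sg; [constructor|];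
      apply rel_ty_subst with (s := inst_subst u0) in R;
      rewrite !map_snd_inst_shift in R; exact R
    end.
  - match goal with S1 : same_shape v ?w, R : rel _ _ (map_snd _ _) _ e ?d0 _ |- _ =>
      pure_case (Unpack (Pack (of_val w)) x d0) (bsubst x (of_val w) d0) u Sg;
      [constructor|];
      match goal with R' : rel _ _ _ _ (of_val v) _ (ty_inst _ ?u0) |- _ =>
        apply rel_ty_subst with (s := inst_subst u0) in R;
        rewrite bcons_map, !map_snd_inst_shift, ty_inst_shift in R;
        eapply rel_bsubst; [auto|exact R|exact R']
      end
    end.
  - match goal with S1 : same_shape v ?w |- _ =>
      pure_case (Unfold (Fold (of_val w))) (of_val w) u Sg; [constructor|assumption]
    end.
  - match goal with S1 : same_shape v ?w, R : rel _ _ _ _ (of_val v) _ ?t |- _ =>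
      destruct (heap_rel_alloc _ _ _ _ _ _ _ Hh H S1 R) as (Sub' & Hu & Hh');
      exists (Ref (of_val w)), (Loc l), (PositiveMap.add l w u), [], ((l, t) :: Sg)
    end.
    split; [ciu|split; [now constructor|split; [auto|split; [|split; [auto|constructor]]]]].
    constructor. simpl. now rewrite Pos.eqb_refl.
  - match goal with E : slookup Sg l = Some _ |- _ =>
      assert (Hl := Hh l); rewrite E in Hl;
      destruct Hl as (v1 & w & Fv & Fw & Sh & Rv)
    end.
    rewrite H in Fv; injection Fv as <-.
    pure_case (Deref (Loc l)) (of_val w) u Sg; [now constructor|assumption].
  - match goal with E : slookup Sg l = Some _, S1 : same_shape v ?w' |- _ =>
      assert (Hl := Hh l); rewrite E in Hl;
      destruct Hl as (v1 & w2 & Fv & Fw & Sh & Rv);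
      exists (Store (Loc l) (of_val w')), Unit, (PositiveMap.add l w' u), [], Sg
    end.
    split; [ciu|split; [econstructor; eauto|split; [auto|split; [constructor|split]]]];
      [eapply heap_rel_update; eauto|constructor].
  - match goal with E : slookup Sg l = Some _,
      S1 : same_shape v1 ?w1, S2 : same_shape v2 ?w2 |- _ =>
      assert (Hl := Hh l); rewrite E in Hl;
      destruct Hl as (x0 & y0 & Fv & Fw & Sh & Rv);
      rewrite H in Fv; injection Fv as <-;
      assert (Bv : base_val v1) by eauto using rel_cas_base;
      assert (w1 = v1) as -> by eauto using same_shape_base_l;
      assert (y0 = v1) as -> by eauto using same_shape_base_l;
      exists (CAS (Loc l) (of_val v1) (of_val w2)), (Bool true),
        (PositiveMap.add l w2 u), [], Sg
    end.
    split; [ciu|split; [econstructor; eauto|split; [auto|split; [constructor|split]]]];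
      [eapply heap_rel_update; eauto|constructor].
  (* For failure the shapes are read backwards: if the right cell held the base value [v1], the left
     cell would hold it too. *)
  - match goal with E : slookup Sg l = Some _,
      S1 : same_shape v1 ?w1, S2 : same_shape v2 ?w2 |- _ =>
      assert (Hl := Hh l); rewrite E in Hl;
      destruct Hl as (x0 & y0 & Fv & Fw & Sh & Rv);
      rewrite H in Fv; injection Fv as <-;
      assert (Bv : base_val v1) by eauto using rel_cas_base;
      assert (w1 = v1) as -> by eauto using same_shape_base_l;
      pure_case (CAS (Loc l) (of_val v1) (of_val w2)) (Bool false) u Sg;
      [apply (HS_CASFail _ y0); auto; intros ->; eauto using same_shape_base_r
      |constructor]
    end.
  - match goal with R : rel _ _ _ _ e ?d0 _ |- _ =>
      exists (Fork d0), Unit, u, [d0], Sg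
    end.
    split; [ciu|split; [constructor|split; [auto|split; [constructor|split; [auto|]]]]].
    constructor; eauto.
Qed.

Lemma rel_conv_aux ts s :
  conv ts s -> forall Sg us u,
  Forall2 (fun e d => exists t, rel B true Sg [] e d t) ts us ->
  heap_rel Sg s u -> closed_config us u -> conv us u.
Proof.
  induction 1 as [v efs s|ts1 K e ts2 s e' s' efs H C IH]; intros Sg us u R Hh W.
  - inversion R as [|? d ? ds [t Rd] Rs]; subst.
    destruct (rel_val _ _ _ _ Rd) as (w & [_ Cw] & _).
    apply (Cw [] KHole ds u W). constructor.
  - apply Forall2_app_inv_l in R as (us1 & us2' & R1 & R2 & ->).
    inversion R2 as [|? D ? us2 [t RD] R3]; subst.
    destruct (rel_fill _ _ _ _ _ RD) as (K' & d & t' & Rd & C1 & F).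
    destruct (rel_head_step _ _ _ _ _ _ _ _ _ H Rd Hh)
      as (d2 & d' & u' & dfs & Sg' & C2 & Hd & Sub & Rd' & Hh' & Rf).
    assert (C3 : ciu_le (fill K' d2) D)
      by (eapply ciu_le_trans; [apply ciu_le_fill, C2|exact C1]).
    (* It now suffices that the pool with [fill K' d2] in place of [D] converges; [L3] keeps that
       pool free of dangling locations. *)
    destruct C3 as [L3 C3]. apply (C3 us1 KHole us2 u W). simpl.
    assert (Wk : forall ts us,
      Forall2 (fun e d => exists t, rel B true Sg [] e d t) ts us ->
      Forall2 (fun e d => exists t, rel B true Sg' [] e d t) ts us).
    { induction 1 as [|? ? ? ? [? ?]]; constructor; eauto using rel_weaken_store. }
    eapply conv_step; [exact Hd|].
    apply (IH Sg'); auto.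
    + apply Forall2_app; auto. constructor; [eauto|]. apply Forall2_app; auto.
    + eapply closed_config_step; [constructor; exact Hd|].
      destruct W as [W Wu]; split; auto.
      apply Forall_app in W as [W1 W2]; inversion W2; subst.
      apply Forall_app; split; auto.
Qed.

Lemma rel_conv e d t :
  rel B true [] [] e d t -> conv [e] empty_state -> conv [d] empty_state.
Proof.
  intros R C. apply (rel_conv_aux _ _ C [] [d] empty_state).
  - constructor; eauto.
  - intros l. unfold empty_state. now rewrite PositiveMap.gempty.
  - split.
    + constructor; auto. eapply rel_loc_free; [|exact R|now intros].
      intros a b t' Hb. apply (HB _ _ _ Hb).
    + intros l v F. unfold empty_state in F. now rewrite PositiveMap.gempty in F.
Qed.

End Good.

Inductive single_base (a b : expr) (t : ty) : expr -> expr -> ty -> Prop :=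
| Single_base : single_base a b t a b t.

Lemma rel_plug a b t C Xi G t' :
  typed_ctx 0 [] t C Xi G t' ->
  forall Sg, rel (single_base a b t) true Sg G (plug C a) (plug C b) t'.
Proof.
  induction 1; intros Sg; simpl; try (econstructor; eauto using typed_rel; fail).
  (* At the hole the base pair is used at its own type, that is, under the identity substitution. *)
  assert (R := R_Base _ Sg [] a b t TVar (Single_base a b t)).
  now rewrite ty_subst_id in R.
Qed.

(** * The equivalences *)

Lemma rel_subst_closed B k Sg G e d t :
  closed_base B -> rel B k Sg G e d t ->
  forall x v, lookup G x = None -> subst x v e = e.
Proof.
  intros HB; induction 1; intros y v Hy; simpl; f_equal; auto.
  - destruct (String.eqb y x) eqn:E; auto. apply String.eqb_eq in E. congruence.
  - destruct (binds x1 y) eqn:E; auto. apply IHrel2. now rewrite lookup_bcons_other.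
  - destruct (binds x2 y) eqn:E; auto. apply IHrel3. now rewrite lookup_bcons_other.
  - destruct (binds f y || binds x y) eqn:E; auto. apply IHrel.
    apply orb_false_iff in E as [? ?]. now rewrite !lookup_bcons_other.
  - apply IHrel. now rewrite lookup_map, Hy.
  - destruct (binds x y) eqn:E; auto. apply IHrel2.
    now rewrite lookup_bcons_other, lookup_map, Hy.
  - apply (HB _ _ _ H).
Qed.

(* Typing without well-formedness of types: for [typed], the composite programs
   would need that the type of a typed term is well formed. *)
Definition wt (e : expr) (t : ty) : Prop :=
  rel (fun _ _ _ => False) false [] [] e e t.

Lemma wt_subst_closed e t : wt e t -> subst_closed e.
Proof. intros H x v. eapply rel_subst_closed; [|exact H|auto]. now intros ? ? ?. Qed.

Lemma wt_loc_free e t : wt e t -> loc_free e.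
Proof. intros H P. eapply rel_loc_free; [|exact H|]; now intros. Qed.

Lemma wt_weaken e t k G : wt e t -> rel (fun _ _ _ => False) k [] G e e t.
Proof.
  intros H. assert (R : rel (fun _ _ _ => False) k [] [] e e t).
  { destruct k; [now apply rel_true in H|exact H]. }
  eapply rel_weaken; [exact R| |]; now intros ? ?.
Qed.

Lemma typed_wt e t : typed 0 [] e t -> wt e t.
Proof. intros H. now apply (typed_rel _ _ _ _ _ H). Qed.

Lemma wt_diverge t : wt diverge t.
Proof. repeat (econstructor; simpl; eauto). Qed.

Lemma wt_seq e1 e2 t1 t : wt e1 t1 -> wt e2 t -> wt (Seq e1 e2) t.
Proof.
  intros H1 H2. eapply R_App; [apply R_Rec; simpl|]; apply wt_weaken; eassumption.
Qed.

Lemma wt_choice e1 e2 t : wt e1 t -> wt e2 t -> wt (choice e1 e2) t.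
Proof.
  intros H1 H2.
  eapply R_App with (t1 := TArrow TUnit t);
    [eapply R_App with (t1 := TArrow TUnit t)
    |constructor; apply wt_weaken; exact H2];
    [|constructor; apply wt_weaken; exact H1].
  repeat (econstructor; simpl; eauto).
Qed.

Lemma ciu_le_ctx_refines a b t t' :
  wt a t -> wt b t' -> ciu_le a b -> ctx_refines 0 [] a b t.
Proof.
  intros Ha Hb C u P HP v efs s H.
  apply conv_tp_steps. apply tp_steps_conv in H. revert H.
  apply (rel_conv (single_base a b t)) with (t := u); [|now apply rel_plug with (Xi := 0)].
  intros ? ? ? [].
  repeat split; eauto using wt_subst_closed; try apply C.
  - now apply (wt_loc_free b t').
  (* Typing relates [a] to itself over the empty base, hence without [B] at the root over any
     base. *)
  - eapply rel_mono; [|exact Ha]. now intros.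
Qed.

Lemma ciu_equiv_ctx_equiv e d t : wt e t -> wt d t ->
  (forall ts1 K ts2 s, closed_config (ts1 ++ fill K Unit :: ts2) s ->
    conv (ts1 ++ fill K e :: ts2) s <-> conv (ts1 ++ fill K d :: ts2) s) ->
  ctx_equiv e d t.
Proof.
  intros He Hd H. split; eapply ciu_le_ctx_refines; eauto; split.
  - intros P _. now apply (wt_loc_free e t).
  - intros ts1 K ts2 s W. apply closed_config_fill in W as [W _]. now apply H.
  - intros P _. now apply (wt_loc_free d t).
  - intros ts1 K ts2 s W. apply closed_config_fill in W as [W _]. now apply H.
Qed.

Lemma conv_seq_choice e1 e2 e3 t ts1 K ts2 s :
  wt e1 t -> wt e2 t -> wt e3 t ->
  closed_config (ts1 ++ fill K Unit :: ts2) s ->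
  conv (ts1 ++ fill K (Seq e1 (choice e2 e3)) :: ts2) s <->
  conv (ts1 ++ fill K (Seq e1 e2) :: ts2) s \/ conv (ts1 ++ fill K (Seq e1 e3) :: ts2) s.
Proof.
  intros H1 H2 H3 W.
  assert (W1 : closed_config (ts1 ++ fill K e1 :: ts2) s)
    by (apply closed_config_fill; split; [exact W|apply (wt_loc_free _ _ H1)]).
  assert (Ch : forall ts1 ts2 s, closed_config (ts1 ++ fill K Unit :: ts2) s ->
    conv (ts1 ++ fill K (choice e2 e3) :: ts2) s <->
    conv (ts1 ++ fill K e2 :: ts2) s \/ conv (ts1 ++ fill K e3 :: ts2) s).
  { intros; apply conv_choice; eauto using wt_subst_closed, wt_loc_free. }
  split.
  - intros C.
    destruct (conv_seq_replace (fun f => f = e2 \/ f = e3) K (choice e2 e3)) with (4 := C)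
      as (f & [->| ->] & Hf); eauto.
    intros ts1' ts2' s' W' C'. apply Ch in C'; auto. destruct C'; eauto.
  - assert (B : forall x, x = e2 \/ x = e3 ->
      conv (ts1 ++ fill K (Seq e1 x) :: ts2) s ->
      conv (ts1 ++ fill K (Seq e1 (choice e2 e3)) :: ts2) s).
    { intros x Hx C.
      destruct (conv_seq_replace (fun f => f = choice e2 e3) K x) with (4 := C)
        as (f & -> & Hf); eauto.
      intros ts1' ts2' s' W' C'. exists (choice e2 e3). split; auto.
      apply Ch; auto. destruct Hx as [->| ->]; auto. }
    intros [C|C]; eauto.
Qed.

Local Open Scope lang_scope.
Theorem mainTheorem8 (t : ty) (e1 e2 e3 : expr)
    (He1 : typed 0 [] e1 t) (He2 : typed 0 [] e2 t) (He3 : typed 0 [] e3 t) :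
  ctx_equiv e1 (e1 ⊕ e1) t /\
  ctx_equiv (e1 ⊕ e2) (e2 ⊕ e1) t /\
  ctx_equiv e1 (e1 ⊕ diverge) t /\
  ctx_equiv (e1 ⊕ (e2 ⊕ e3)) ((e1 ⊕ e2) ⊕ e3) t /\
  ctx_equiv ((e1 ⊕ e2) ;; e3) ((e1 ;; e3) ⊕ (e2 ;; e3)) t /\
  ctx_equiv (e1 ;; (e2 ⊕ e3)) ((e1 ;; e2) ⊕ (e1 ;; e3)) t.
Proof.
  assert (H1 := typed_wt _ _ He1). assert (H2 := typed_wt _ _ He2).
  assert (H3 := typed_wt _ _ He3). assert (Hd := wt_diverge t).
  assert (Ch : forall a b, wt a t -> wt b t -> forall ts1 K ts2 s,
    closed_config (ts1 ++ fill K Unit :: ts2) s ->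
    conv (ts1 ++ fill K (choice a b) :: ts2) s <->
    conv (ts1 ++ fill K a :: ts2) s \/ conv (ts1 ++ fill K b :: ts2) s).
  { intros a b Ha Hb ts1 K ts2 s.
    apply conv_choice; eauto using wt_subst_closed, wt_loc_free. }
  assert (ChSeq : forall a b c, wt a t -> wt b t -> wt c t -> forall ts1 K ts2 s,
    closed_config (ts1 ++ fill K Unit :: ts2) s ->
    conv (ts1 ++ fill K (Seq (choice a b) c) :: ts2) s <->
    conv (ts1 ++ fill K (Seq a c) :: ts2) s \/ conv (ts1 ++ fill K (Seq b c) :: ts2) s).
  { intros a b c Ha Hb Hc ts1 K ts2 s W.
    (* The first component of a sequence is in evaluation position, so the frame with [c] joins the
       context [K]. *)
    assert (E := Ch a b Ha Hb ts1 (comp K (KAppR (Lam BAnon c) KHole)) ts2 s).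
    rewrite !fill_comp in E. apply E. rewrite ?fill_comp. apply closed_config_fill.
    split; [exact W|]. split; [apply (wt_loc_free c t Hc)|exact I]. }
  split; [|split; [|split; [|split; [|split]]]].
  all: apply ciu_equiv_ctx_equiv; eauto 6 using wt_choice, wt_seq.
  all: intros ts1 K ts2 s W.
  - rewrite Ch by auto. tauto.
  - rewrite !Ch by auto. tauto.
  - rewrite Ch by auto. split; auto. intros [C|C]; auto. now apply conv_diverge_inv.
  - rewrite !Ch by auto using wt_choice. tauto.
  - rewrite (Ch (Seq e1 e3) (Seq e2 e3)), ChSeq by eauto using wt_seq. tauto.
  - rewrite (Ch (Seq e1 e2) (Seq e1 e3)) by eauto using wt_seq.
    now apply conv_seq_choice with t.
Qed.
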